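(* Let $n\ge 1$, let $\alpha_j,p_j,\beta_j,q_j,w_j^{(1)},w_j^{(2)}>0$ for $1\le j\le n$, let $X_1,\dots,X_n,Y_1,\dots,Y_n$ be independent random variables with $X_j\sim Ga(\alpha_j,p_j)$ and $Y_j\sim Ga(\beta_j,q_j)$, and let $T_n=\sum_{j=1}^n(w_j^{(1)}X_j-w_j^{(2)}Y_j)$. For $m\ge1$ let $Z_m$ be a compound Poisson random variable with characteristic function $$\phi_m(z)=\exp\Big(m\big(\phi_{T_n}^{1/m}(z)-1\big)\Big),\quad z\in\mathbb{R}.$$ Then there is a constant $c>0$ such that $$d_K(Z_m,T_n)\le c\,\Big(\sum_{j=1}^2|C_j(T_n)|\Big)^{2/5}\Big(\frac1m\Big)^{1/5}\qquad\text{for all integers } m\ge1.$$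
   Context: $Ga(a,s)$ ($a,s>0$) is the gamma distribution with rate $a$ and shape $s$, i.e. with characteristic function $z\mapsto(1-iz/a)^{-s}$. $\phi_{T_n}(z)=\exp\big(\int_{\mathbb{R}}(e^{izu}-1)\nu_{T_n}(du)\big)$ is the characteristic function of $T_n$, with Lévy measure $$\nu_{T_n}(du)=\frac1u\sum_{j=1}^n\Big(p_je^{-\alpha_ju/w_j^{(1)}}\mathbf 1_{(0,\infty)}(u)-q_je^{-\beta_j|u|/w_j^{(2)}}\mathbf 1_{(-\infty,0)}(u)\Big)du,$$ and $\phi_{T_n}^{1/m}(z)=\exp\big(\frac1m\int_{\mathbb{R}}(e^{izu}-1)\nu_{T_n}(du)\big)$. $C_k(T_n)=(k-1)!$ times $\int_{\mathbb{R}}u^k\nu_{T_n}(du)\big/(k-1)!$, i.e. for $k=1,2$, $C_k(T_n)=\int_{\mathbb{R}}u^k\nu_{T_n}(du)$, is the $k$-th cumulant of $T_n$ (so $C_1(T_n)=\mathbb{E}(T_n)$, $C_2(T_n)=\mathrm{Var}(T_n)$). $d_K(Y,Z)=\sup_{x\in\mathbb{R}}|P(Y\le x)-P(Z\le x)|$ is the Kolmogorov distance. *)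

(* Defs.v *)
From HB Require Import structures.
From mathcomp Require Import all_boot all_order all_algebra.
From mathcomp Require Import all_classical all_reals all_analysis.
From mathcomp Require Import complex.
Set Implicit Arguments.
Unset Strict Implicit.
Unset Printing Implicit Defensive.
Import Order.TTheory GRing.Theory Num.Theory.
Import numFieldNormedType.Exports.

Local Open Scope classical_set_scope.
Local Open Scope ring_scope.
Local Open Scope complex_scope.

Section ComplexFunctions.
Context {R : realType}.
Implicit Types w : R[i].

Definition cexp w : R[i] :=
  (expR (complex.Re w))%:C * (cos (complex.Im w) +i* sin (complex.Im w)).

(* principal argument, with values in ]-pi, pi] for w != 0 *)
Definition carg w : R :=
  let t := acos (complex.Re w / Normc.normc w) in
  if 0 <= complex.Im w then t else - t.

Definition clog w : R[i] := ln (Normc.normc w) +i* carg w.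

(* principal branch of w ^ s, for w != 0 *)
Definition cpow w (s : R) : R[i] := cexp (s%:C * clog w).

Definition cintegral d (T : measurableType d) (mu : {measure set T -> \bar R})
    (f : T -> R[i]) : R[i] :=
  (\int[mu]_x complex.Re (f x))%R +i* (\int[mu]_x complex.Im (f x))%R.

End ComplexFunctions.

Section Probability.
Context {R : realType}.

Definition charfun (mu : probability R R) (z : R) : R[i] :=
  cintegral mu (fun u => cexp ('i * (z * u)%:C)).

Definition mutually_independent d (T : measurableType d) (P : probability T R)
    (I : finType) (X : I -> {RV P >-> R}) : Prop :=
  forall (J : {set I}) (B : I -> set R), (forall i, measurable (B i)) ->
    P (\bigcap_(i in [set` J]) X i @^-1` B i) =
    (\prod_(i in J) P (X i @^-1` B i))%E.

Definition is_gamma (mu : probability R R) (a s : R) : Prop :=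
  forall z : R, charfun mu z = cpow (1 - 'i * (z / a)%:C) (- s).

Definition is_compound_poisson (mu : probability R R) : Prop :=
  exists (lam : R) (sigma : probability R R),
    [/\ 0 < lam, sigma [set 0] = 0%E &
        forall z : R, charfun mu z = cexp (lam%:C * (charfun sigma z - 1))].

Definition kolmogorov_dist d (T : measurableType d) (P : probability T R)
    d' (T' : measurableType d') (P' : probability T' R)
    (Y : {RV P >-> R}) (Z : {RV P' >-> R}) : R :=
  sup (range (fun x : R => `|fine (cdf Y x) - fine (cdf Z x)|)).

End Probability.

Section LevyMeasure.
Context {R : realType} {n : nat}.
Variables alpha p beta q w1 w2 : 'I_n -> R.

(* density of nu_{T_n} with respect to Lebesgue measure *)
Definition levy_density (u : R) : R :=
  u^-1 * \sum_(j < n)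
    (p j * expR (- (alpha j * u / w1 j)) * \1_(`]0, +oo[) u
     - q j * expR (- (beta j * `|u| / w2 j)) * \1_(`]-oo, 0[) u).

(* the integral of f against nu_{T_n}(du) = levy_density u du *)
Definition levy_integral (f : R -> R[i]) : R[i] :=
  cintegral (@lebesgue_measure R) (fun u => (levy_density u)%:C * f u).

(* phi_{T_n}^{1/m}; the root is defined by dividing the exponent by m, so that
   no branch has to be chosen *)
Definition phi_root (m : nat) (z : R) : R[i] :=
  cexp (m%:R^-1 * levy_integral (fun u => cexp ('i * (z * u)%:C) - 1)).

Definition cumulant (k : nat) : R :=
  (\int[@lebesgue_measure R]_u (u ^+ k * levy_density u))%R.

End LevyMeasure.

(* Main.v *)
Require Import Defs.
From HB Require Import structures.
From mathcomp Require Import all_boot all_order all_algebra.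
From mathcomp Require Import all_classical all_reals all_analysis.
From mathcomp Require Import complex.
From mathcomp Require Import ring lra measurable_realfun.
Set Implicit Arguments.
Unset Strict Implicit.
Unset Printing Implicit Defensive.
Import Order.TTheory GRing.Theory Num.Theory.
Import numFieldNormedType.Exports.
Local Open Scope classical_set_scope.
Local Open Scope ring_scope.

(** The characteristic function of [T] is [exp psi], where [psi = a + i b] is
    explicit. A gamma factor [(1 - i y)^(-s)] has logarithm
    [- s (log (1 + y^2) / 2 - i atan y)] ([gamma_transform]), independence turns
    sums into products ([independent_trig_sum]), and the Levy integral that
    defines [phi^(1/m)] is a sum of Frullani integrals with the same value
    ([frullani_trig], [levy_integralE]). So the characteristic function of
    [Z_m] is [exp (m (exp (psi / m) - 1))]; both exponents have nonpositive real
    part, whence the two characteristic functions differ by [O(|psi|^2 / m)]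
    ([compound_poisson_approx]). Moreover [psi z] is [O(|z|)] at the origin and
    grows only logarithmically ([exponent_sqr_le]).

    The passage to distribution functions is an Esseen-type argument.
    An indicator is squeezed between trapezoids with edges of width [e].
    A trapezoid is a combination of four translates of [|u|], and
    [|u| = c^-1 int_0^oo (1 - cos (z u)) / z^2 dz] for a constant [c] that
    scaling produces; by Fubini, the difference of the two expectations of a
    trapezoid is an integral of the difference of the characteristic functions
    against a kernel bounded by a multiple of [min (2, z e) / (e z^2)]
    ([smoothing_inequality]). Splitting at [z = M >= 1] bounds it by
    [O((1 + log M)^3 / m + 1 / (e M))].

    The shift by [e] costs the mass that [T] gives to an interval of length
    [e]. The density of [T] may be unbounded, but one gamma component already
    makes the characteristic function of [T] decay like [z^(-s)] for some
    [s > 0], and this bounds the mass by a positive power of [e]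
    ([concentration_bound]). With [e] and [M] suitable powers of [m], all the
    terms are [O(m^(-1/5))]; as the second cumulant is positive
    ([cumulant2_gt0]), the cumulants enter the bound through a positive factor
    that the constant absorbs. *)

(** * Integrability and exchange of integrals *)

Section Integrals.
Context d (T : measurableType d) (R : realType).
Variable mu : {measure set T -> \bar R}.

Lemma integrable_of_le (f g : T -> R) : measurable_fun setT f ->
  (forall x, `|f x| <= g x) -> mu.-integrable setT (EFin \o g) ->
  mu.-integrable setT (EFin \o f).
Proof.
move=> mf fg ig; apply: le_integrable ig => //.
  exact/measurable_EFinP.
by move=> x _ /=; rewrite lee_fin (le_trans (fg x))// ler_norm.
Qed.

Lemma Rintegral_EFin (f : T -> R) : mu.-integrable setT (EFin \o f) ->
  (\int[mu]_x (f x)%:E)%E = (\int[mu]_x f x)%R%:E.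
Proof.
by move=> fi; rewrite /Rintegral fineK//; exact: integrable_fin_num.
Qed.

End Integrals.

Section ProductIntegrals.
Context d1 d2 (T1 : measurableType d1) (T2 : measurableType d2) (R : realType).
Variables (m1 : {sigma_finite_measure set T1 -> \bar R})
          (m2 : {sigma_finite_measure set T2 -> \bar R}).
Variables (f : T1 * T2 -> R) (g : T1 -> R) (h : T2 -> R).
Hypotheses (mf : measurable_fun setT f)
  (ig : m1.-integrable setT (EFin \o g)) (ih : m2.-integrable setT (EFin \o h))
  (fgh : forall x y, `|f (x, y)| <= g x * h y).

Let int_slice1 x : m2.-integrable setT (fun y => (f (x, y))%:E).
Proof.
have := integrableZl measurableT (g x) ih.
apply: (@integrable_of_le _ _ _ m2 (fun y => f (x, y)) (fun y => g x * h y)) => //.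
exact: measurableT_comp mf (pair1_measurable x).
Qed.

Let int_slice2 y : m1.-integrable setT (fun x => (f (x, y))%:E).
Proof.
have := integrableZl measurableT (h y) ig.
apply: (@integrable_of_le _ _ _ m1 (fun x => f (x, y)) (fun x => h y * g x)) => //.
  exact: measurableT_comp mf (pair2_measurable y).
by move=> x; rewrite mulrC.
Qed.

Let int_prod : (m1 \x m2)%E.-integrable setT (EFin \o f).
Proof.
have mEf : measurable_fun setT (EFin \o f) by exact/measurable_EFinP.
apply/integrable12ltyP => //.
apply: (@le_lt_trans _ _ (\int[m1]_x ((\int[m2]_y h y)%R%:E * (g x)%:E)))%E.
  apply: ge0_le_integral => //=.
  - by move=> x _; apply: integral_ge0.
  - apply: (measurable_fun_fubini_tonelli_F (abse \o (EFin \o f))) => //=.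
    by apply: measurableT_comp.
  - exact: measurable_int (integrableZl measurableT _ ig).
  - move=> x _.
    rewrite -(Rintegral_EFin ih) muleC -integralZl//.
    apply: ge0_le_integral => //=.
    + exact: measurable_int (integrable_abse (int_slice1 x)).
    + exact: measurable_int (integrableZl measurableT (g x) ih).
    + by move=> y _; rewrite lee_fin.
rewrite integralZl// (Rintegral_EFin ig) -EFinM; exact: ltry.
Qed.

Let FE x : fubini_F m2 (EFin \o f) x = (\int[m2]_y f (x, y))%R%:E.
Proof. by rewrite /fubini_F/= Rintegral_EFin//; exact: int_slice1. Qed.

(** This gives the measurability and integrability of integrals depending on a
    parameter as by-products of Fubini. *)
Lemma integrable_dominated_slice :
  m1.-integrable setT (EFin \o (fun x => \int[m2]_y f (x, y))%R).
Proof.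
have := integrable_fubini_F int_prod.
by apply: eq_integrable => // x _; rewrite FE.
Qed.

(** The pointwise product bound makes every slice integrable, so the
    real-valued integrals can be exchanged without almost-everywhere
    caveats. *)
Lemma Rintegral_exchange :
  (\int[m1]_x \int[m2]_y f (x, y) = \int[m2]_y \int[m1]_x f (x, y))%R.
Proof.
rewrite /Rintegral; congr fine.
transitivity (\int[m1]_x \int[m2]_y (f (x, y))%:E)%E.
  by apply: eq_integral => x _; rewrite Rintegral_EFin//; exact: int_slice1.
rewrite (Fubini int_prod).
by apply: eq_integral => y _; rewrite -Rintegral_EFin//; exact: int_slice2.
Qed.

End ProductIntegrals.

(** * Scaling of Lebesgue measure *)

Section Lebesgue.
Context {R : realType}.
Local Notation mu := (@lebesgue_measure R).

(** Both sides are measures in [A] that agree on intervals; a negative [k] is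
    allowed, so this also covers reflection. *)
Lemma lebesgue_measure_scale (k : R) (A : set R) : k != 0 -> measurable A ->
  mu A = (`|k|%:E * mu ( *%R k @^-1` A))%E.
Proof.
move=> k0 mA.
have mk : measurable_fun setT ( *%R k : R -> measurableTypeR R) by exact:
  measurable_funM.
have k0' : 0 < `|k| by rewrite normr_gt0.
pose m : {measure set (measurableTypeR R) -> \bar R} :=
  mscale (NngNum (normr_ge0 k))
    (pushforward mu ( *%R k : R -> measurableTypeR R)).
suff : mu A = m mk A by [].
apply: (@lebesgue_measure_unique R (m mk)) => // _ [[a b] _ <-]/=.
rewrite /m /mscale/= /pushforward.
have -> : ( *%R k : R -> measurableTypeR R) @^-1` `]a, b] =
   if 0 < k then `]a / k, b / k]%classic else `[b / k, a / k[%classic.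
  apply/seteqP; case: ltP => kp; split => x /=; rewrite !in_itv/=.
  - by rewrite ltr_pdivrMr// ler_pdivlMr// mulrC.
  - by rewrite ltr_pdivrMr// ler_pdivlMr// mulrC.
  - have kn : k < 0 by rewrite lt_neqAle k0.
    by rewrite ltr_ndivlMr// ler_ndivrMr// mulrC andbC.
  - have kn : k < 0 by rewrite lt_neqAle k0.
    by rewrite ltr_ndivlMr// ler_ndivrMr// mulrC andbC.
case: ltP => kp.
  rewrite !lebesgue_measure_itv/= !lte_fin ltr_pM2r ?invr_gt0//.
  case: ifP => _; last by rewrite mule0.
  by rewrite -!EFinB -EFinM gtr0_norm// -mulrBl mulrC divfK ?gt_eqF.
have kn : k < 0 by rewrite lt_neqAle k0.
rewrite !lebesgue_measure_itv/= !lte_fin ltr_nM2r ?invr_lt0//.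
case: ifP => _; last by rewrite mule0.
by rewrite -!EFinB -EFinM ltr0_norm// -mulrBl mulNr mulrC divfK ?lt_eqF// opprB.
Qed.

Let pos_scale (k : R) (f : R -> \bar R) : k != 0 -> measurable_fun setT f ->
  (forall x, 0 <= f x)%E ->
  (\int[mu]_x f x = `|k|%:E * \int[mu]_x f (k * x)%R)%E.
Proof.
move=> k0 mf f0.
have mk : measurable_fun setT ( *%R k : R -> measurableTypeR R) by exact:
  measurable_funM.
pose m : {measure set (measurableTypeR R) -> \bar R} :=
  mscale (NngNum (normr_ge0 k))
    (pushforward mu ( *%R k : R -> measurableTypeR R)).
rewrite (@eq_measure_integral _ _ _ _ (m mk)); last first.
  by move=> A mA _; exact: (lebesgue_measure_scale k0 mA).
rewrite ge0_integral_mscale//= ge0_integral_pushforward//.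
Qed.

Lemma integrable_scale (k : R) (f : R -> R) : k != 0 ->
  mu.-integrable setT (EFin \o f) ->
  mu.-integrable setT (EFin \o (fun x => f (k * x))).
Proof.
move=> k0 /integrableP[mf fi].
have mk : measurable_fun setT ( *%R k : R -> R) by exact: measurable_funM.
apply/integrableP; split.
  exact: (measurableT_comp mf mk).
have mf' : measurable_fun setT (abse \o (EFin \o f)) by exact: measurableT_comp.
move: fi; rewrite (pos_scale k0 mf')//=.
have k0' : 0 < `|k| by rewrite normr_gt0.
have : (0 <= \int[mu]_x `|(f (k * x))%:E|)%E by exact: integral_ge0.
rewrite /=; case: (\int[mu]_x `|f (k * x)|%:E)%E => [r _ _|_|//]; first exact: ltry.
by rewrite gt0_muley ?lte_fin.
Qed.

Lemma Rintegral_scale (k : R) (f : R -> R) : k != 0 ->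
  mu.-integrable setT (EFin \o f) ->
  (\int[mu]_x f x = `|k| * \int[mu]_x f (k * x))%R.
Proof.
move=> k0 fi; have fki := integrable_scale k0 fi.
have mf := measurable_int _ fi.
apply: EFin_inj; rewrite EFinM -Rintegral_EFin// -(Rintegral_EFin fki).
pose F := EFin \o f; pose Fk := EFin \o (fun x => f (k * x)).
have -> : (\int[mu]_x (f x)%:E = \int[mu]_x F^\+ x - \int[mu]_x F^\- x)%E.
  exact: integralE.
have -> : (\int[mu]_x (f (k * x))%:E = \int[mu]_x Fk^\+ x - \int[mu]_x Fk^\- x)%E.
  exact: integralE.
rewrite (pos_scale k0 (measurable_funepos mf))//.
rewrite (pos_scale k0 (measurable_funeneg mf))// [RHS]muleBr//.
  by congr (_ * _ - _ * _)%E; apply: eq_integral => x _; rewrite ?funeposE ?funenegE.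
by apply: fin_num_adde_defl; rewrite fin_numN; exact: integrable_neg_fin_num.
Qed.

End Lebesgue.

Local Notation mu := lebesgue_measure.

Lemma eq_lebesgue (R : realType) (f g : R -> R) : f =1 g ->
  (\int[mu]_x f x = \int[mu]_x g x)%R.
Proof. by move=> fg; apply: eq_Rintegral => x _; rewrite fg. Qed.

Lemma eq_integrable_lebesgue (R : realType) (f g : R -> R) : f =1 g ->
  mu.-integrable setT (EFin \o f) -> mu.-integrable setT (EFin \o g).
Proof. by move=> fg; apply: eq_integrable => // x _ /=; rewrite fg. Qed.

Lemma measurable_comp (R : realType) d (T : measurableType d) (h : R -> R)
  (g : T -> R) :
  measurable_fun setT h -> measurable_fun setT g ->
  measurable_fun setT (fun x => h (g x)).
Proof. by move=> mh mg; exact: (measurableT_comp mh mg). Qed.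

Lemma measurable_indic_itv (R : realType) (i : interval R) :
  measurable_fun setT (\1_[set` i] : R -> R).
Proof. by apply: measurable_indic; exact: measurable_itv. Qed.

Lemma indic_itvE (R : realType) (i : interval R) (u : R) :
  \1_[set` i] u = (u \in i)%:R :> R.
Proof. by rewrite indicE; congr (nat_of_bool _)%:R; apply/idP/idP; rewrite inE. Qed.

(** * Differentiation rules and the fundamental theorem on half-lines *)

(** The rules for [is_derive] are restated for functions given by their values,
    so that a primitive is differentiated by composing terms that mirror it. *)
Section Derivatives.
Context {R : realType}.
Implicit Types (f g : R -> R) (x a b : R).

Lemma isd_mul f g x a b : is_derive x 1 f a -> is_derive x 1 g b ->
  is_derive x 1 (fun y => f y * g y) (f x * b + g x * a).
Proof. by move=> fa gb; exact: (is_deriveM fa gb). Qed.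

Lemma isd_add f g x a b : is_derive x 1 f a -> is_derive x 1 g b ->
  is_derive x 1 (fun y => f y + g y) (a + b).
Proof. by move=> fa gb; exact: (is_deriveD fa gb). Qed.

Lemma isd_cst (c x : R) : is_derive x 1 (fun _ : R => c) 0.
Proof. exact: is_derive_cst. Qed.

Lemma isd_id x : is_derive x 1 (fun y : R => y) 1.
Proof. exact: is_derive_id. Qed.

Lemma isd_scale f x a c : is_derive x 1 f a -> is_derive x 1 (fun y => c * f y) (c * a).
Proof.
move=> fa; apply: is_derive_eq (isd_mul (isd_cst c x) fa) _.
by rewrite mulr0 addr0.
Qed.

Lemma isd_comp (h : R -> R) f x a b : is_derive (f x) 1 h b -> is_derive x 1 f a ->
  is_derive x 1 (fun y => h (f y)) (b * a).
Proof. by move=> hb fa; exact: (is_derive1_comp hb fa). Qed.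

Lemma isd_continuous f x a : is_derive x 1 f a -> {for x, continuous f}.
Proof.
by move=> fa; apply: differentiable_continuous; exact/derivable1_diffP.
Qed.

End Derivatives.

Lemma indic_patch (R : realType) (A : set R) (f : R -> R) :
  (fun x => \1_A x * f x) = f \_ A.
Proof.
apply/funext => x; rewrite patchE indicE.
by case: (x \in A); rewrite ?mul1r ?mul0r.
Qed.

(** Integrals over subsets are written with an indicator factor over the whole
    line, the form in which the Levy density is given and in which Fubini
    applies. *)
Lemma ge0_integral_halfline (R : realType) (f F : R -> R) (a l : R) :
  (forall x, a <= x -> 0 <= f x) ->
  (forall x, a <= x -> {for x, continuous f}) ->
  (forall x, a <= x -> is_derive x 1 F (f x)) ->
  F x @[x --> +oo] --> l ->
  mu.-integrable setT (EFin \o (fun x => \1_`]a, +oo[ x * f x)) /\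
  (\int[mu]_x (\1_`]a, +oo[ x * f x) = l - F a)%R.
Proof.
move=> f0 cf dF Fl.
have cfa : {within `[a, +oo[, continuous f}.
  by apply: continuous_in_subspaceT => x; rewrite inE/= in_itv/= andbT => /cf.
have mf : measurable_fun `]a, +oo[ f.
  apply: open_continuous_measurable_fun => // x.
  by rewrite inE/= in_itv/= andbT => /ltW/cf.
have FTC : (\int[mu]_(x in `]a, +oo[) (f x)%:E = l%:E - (F a)%:E)%E.
  rewrite integral_itv_obnd_cbnd; last exact/measurable_EFinP.
  apply: (ge0_continuous_FTC2y f0 cfa Fl).
  - by move=> x /ltW/dF.
  - by apply: cvg_at_right_filter; apply: (isd_continuous (dF a _)).
  - move=> x; rewrite in_itv/= andbT => /ltW/dF dFx.
    by rewrite derive1E; exact: derive_val.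
have fi : mu.-integrable `]a, +oo[ (EFin \o f).
  apply/integrableP; split; first exact/measurable_EFinP.
  have -> : (\int[mu]_(x in `]a, +oo[) `|(EFin \o f) x| =
             \int[mu]_(x in `]a, +oo[) (f x)%:E)%E.
    apply: eq_integral => x; rewrite inE/= in_itv/= andbT => /ltW/f0 fx0.
    by rewrite /= ger0_norm.
  by rewrite FTC -EFinB ltry.
rewrite indic_patch; split.
  rewrite -restrict_EFin.
  by apply: (proj1 (@integrable_mkcond _ _ R mu _ (EFin \o f) _) fi);
    exact: measurable_itv.
by rewrite -Rintegral_mkcond /Rintegral FTC.
Qed.

(** * Laplace transforms and Frullani integrals *)

(** The value [0^-1 = 0] makes [x^-1 = x (x^2)^-1] an identity on the whole
    line, where the inverse of a square is a real power. *)
Lemma measurable_inv (R : realType) : measurable_fun setT (fun x : R => x^-1).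
Proof.
have -> : (fun x : R => x^-1) = (fun x : R => x * (x ^+ 2) `^ (-1)).
  apply/funext => x; rewrite powR_inv1 ?sqr_ge0//.
  have [->|x0] := eqVneq x 0; first by rewrite mul0r invr0.
  by rewrite expr2 invfM mulrA divff// mul1r.
apply: measurable_funM => //.
apply: (measurableT_comp (f := fun x : R => x `^ (-1))) => //.
Qed.

Lemma cvg_expR_bounded (R : realType) (b K : R) (G : R -> R) : 0 < b ->
  (forall x, `|G x| <= K) -> (expR (- (b * x)) * G x) @[x --> +oo] --> (0 : R).
Proof.
move=> b0 GK.
have e0 : expR (- (b * x)) @[x --> +oo] --> (0 : R).
  have := @cvg_comp _ _ _ (fun x : R => b * x) (fun x => expR (- x)) _ _ _
    (gt0_cvgMry b0 cvg_id) (@cvgr_expR R).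
  exact.
have e0' c : c * expR (- (b * x)) @[x --> +oo] --> (0 : R).
  by rewrite -(mulr0 c); apply: cvgM => //; exact: cvg_cst.
apply: (squeeze_cvgr _ (e0' (- K)) (e0' K)).
apply: nearW => x; have := GK x; rewrite ler_norml => /andP[h1 h2].
by rewrite ![_ * expR _]mulrC !ler_pM2l ?expR_gt0// h1 h2.
Qed.

Lemma integral_expR_halfline (R : realType) (b : R) : 0 < b ->
  mu.-integrable setT (EFin \o (fun u : R => \1_`]0, +oo[ u * expR (- (b * u)))) /\
  (\int[mu]_u (\1_`]0, +oo[ u * expR (- (b * u))) = b^-1)%R.
Proof.
move=> b0.
have := @ge0_integral_halfline R (fun u => expR (- (b * u)))
   (fun u => expR (- (b * u)) * (- b^-1)) 0 0.
rewrite mulr0 oppr0 expR0 mul1r sub0r opprK; apply.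
- by move=> *; exact: expR_ge0.
- move=> x _; have := isd_comp (is_derive_expR _) (isd_scale (- b) (isd_id x)).
  by under eq_fun do rewrite mulNr; exact: isd_continuous.
- move=> x _.
  have := isd_mul (isd_comp (is_derive_expR _) (isd_scale (- b) (isd_id x)))
    (isd_cst (- b^-1) x).
  under eq_fun do rewrite mulNr.
  by move=> H; apply: is_derive_eq H _; rewrite mulNr; field; rewrite gt_eqF.
- apply: (@cvg_expR_bounded _ _ (`|- b^-1|)) => //.
Qed.

(** The integrand changes sign, whereas the fundamental theorem on a half-line
    is for nonnegative functions: the constant [K] is added to the trigonometric
    factor and subtracted again at the end. *)
Lemma laplace_trig (R : realType) (b t x y : R) : 0 < b ->
  mu.-integrable setT (EFin \o (fun u : R => \1_`]0, +oo[ u *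
     (expR (- (b * u)) * (x * cos (t * u) + y * sin (t * u))))) /\
  (\int[mu]_u (\1_`]0, +oo[ u *
     (expR (- (b * u)) * (x * cos (t * u) + y * sin (t * u)))) =
   (x * b + y * t) / (b ^+ 2 + t ^+ 2))%R.
Proof.
move=> b0; pose K : R := `|x| + `|y|.
have bt0 : b ^+ 2 + t ^+ 2 != 0.
  by rewrite gt_eqF// ltr_pwDl ?exprn_gt0// sqr_ge0.
have xyK (u : R) : `|x * cos (t * u) + y * sin (t * u)| <= K.
  rewrite (le_trans (ler_normD _ _))// !normrM lerD// ler_piMr// ?cos_max ?sin_max//.
have H (u : R) : is_derive u 1 (fun v : R => expR (- (b * v)) *
    (- (K / b) + (b ^+ 2 + t ^+ 2)^-1 * ((x * t - y * b) * sin (t * v)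
        + (- (x * b + y * t)) * cos (t * v))))
    (expR (- (b * u)) * (K + (x * cos (t * u) + y * sin (t * u)))).
  have dt := isd_scale t (isd_id u).
  have de := isd_comp (is_derive_expR _) (isd_scale (- b) (isd_id u)).
  move: de; under eq_fun do rewrite mulNr; rewrite mulNr => de.
  have ds := isd_scale (x * t - y * b) (isd_comp (is_derive_sin _) dt).
  have dc := isd_scale (- (x * b + y * t)) (isd_comp (is_derive_cos _) dt).
  have := isd_mul de (isd_add (isd_cst (- (K / b)) u) (isd_scale
    (b ^+ 2 + t ^+ 2)^-1 (isd_add ds dc))).
  move=> D; apply: is_derive_eq D _; field.
  by rewrite bt0 gt_eqF.
have [] := @ge0_integral_halfline R _ _ 0 0 _ _ (fun u _ => H u).
- move=> u _; rewrite mulr_ge0 ?expR_ge0//.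
  by have := xyK u; rewrite ler_norml => /andP[+ _]; lra.
- move=> u _.
  have dt := isd_scale t (isd_id u).
  have de := isd_comp (is_derive_expR _) (isd_scale (- b) (isd_id u)).
  move: de; under eq_fun do rewrite mulNr; rewrite mulNr => de.
  have ds := isd_scale y (isd_comp (is_derive_sin _) dt).
  have dc := isd_scale x (isd_comp (is_derive_cos _) dt).
  exact: isd_continuous (isd_mul de (isd_add (isd_cst K u) (isd_add dc ds))).
- apply: (@cvg_expR_bounded _ _ (`|K / b| + `|(b ^+ 2 + t ^+ 2)^-1| *
     (`|x * t - y * b| + `|x * b + y * t|))) => // v.
  rewrite (le_trans (ler_normD _ _))// normrN lerD// normrM ler_wpM2l//.
  rewrite (le_trans (ler_normD _ _))// !normrM lerD// ?normrN ler_piMr// ?cos_max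
    ?sin_max//.
move=> i1 e1.
have [i2 e2] := integral_expR_halfline b0.
have i3 := integrableZl measurableT K i2.
have E (u : R) : \1_`]0, +oo[ u * (expR (- (b * u)) * (x * cos (t * u) + y * sin
  (t * u)))
  = \1_`]0, +oo[ u * (expR (- (b * u)) * (K + (x * cos (t * u) + y * sin (t * u))))
    - K * (\1_`]0, +oo[ u * expR (- (b * u))) by ring.
split.
  have := integrableB measurableT i1 i3.
  by apply: eq_integrable => // u _ /=; rewrite E.
rewrite (eq_lebesgue E) RintegralB// e1 RintegralZl// e2.
rewrite !mulr0 oppr0 expR0 sin0 cos0; field.
by rewrite bt0 gt_eqF.
Qed.
Lemma measurable_cos (R : realType) : measurable_fun setT (@cos R).
Proof. by apply: continuous_measurable_fun; exact: continuous_cos. Qed.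

Lemma measurable_sin (R : realType) : measurable_fun setT (@sin R).
Proof. by apply: continuous_measurable_fun; exact: continuous_sin. Qed.

Lemma integral_segment (R : realType) (f F : R -> R) (a b : R) : a < b ->
  (forall x, a <= x <= b -> {for x, continuous f}) ->
  (forall x, a <= x <= b -> is_derive x 1 F (f x)) ->
  mu.-integrable setT (EFin \o (fun x => \1_`[a, b] x * f x)) /\
  (\int[mu]_x (\1_`[a, b] x * f x) = F b - F a)%R.
Proof.
move=> ab cf dF.
have cfa : {within `[a, b], continuous f}.
  by apply: continuous_in_subspaceT => x; rewrite inE/= in_itv/= => /cf.
have FTC : (\int[mu]_(x in `[a, b]) (f x)%:E = (F b)%:E - (F a)%:E)%E.
  apply: (continuous_FTC2 ab cfa).
  - split.
    + by move=> x /subset_itv_oo_cc; rewrite in_itv/= => /dF.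
    + by apply: cvg_at_right_filter; apply: (isd_continuous (dF a _)); rewrite lexx ltW.
    + by apply: cvg_at_left_filter; apply: (isd_continuous (dF b _)); rewrite lexx ltW.
  - move=> x /subset_itv_oo_cc; rewrite in_itv/= => /dF dFx.
    by rewrite derive1E; exact: derive_val.
have fi : mu.-integrable `[a, b] (EFin \o f).
  by apply: continuous_compact_integrable => //; exact: segment_compact.
rewrite indic_patch; split.
  rewrite -restrict_EFin.
  by apply: (proj1 (@integrable_mkcond _ _ R mu _ (EFin \o f) _) fi);
    exact: measurable_itv.
by rewrite -Rintegral_mkcond /Rintegral FTC.
Qed.

Lemma integrable_indic_segment (R : realType) (a b : R) : a < b ->
  mu.-integrable setT (EFin \o (\1_`[a, b] : R -> R)).
Proof.
move=> ab.
have [i _] := @integral_segment R (fun=> 1) (fun x => x) a b ab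
  (fun x _ => isd_continuous (isd_cst 1 x)) (fun x _ => isd_id x).
by apply: eq_integrable_lebesgue i => x; rewrite mulr1.
Qed.

(** Writing the quotient by [u] as an average over [s] in the unit interval,
    [u^-1 sin (z u)] being the integral of [z cos (s z u)], turns the Frullani
    integral into an iterated Laplace transform that Fubini evaluates. *)
Lemma frullani_trig (R : realType) (b z x y : R) : 0 < b ->
  mu.-integrable setT (EFin \o (fun u : R => \1_`]0, +oo[ u *
     (u^-1 * expR (- (b * u)) * (x * sin (z * u) + y * (1 - cos (z * u)))))) /\
  (\int[mu]_u (\1_`]0, +oo[ u *
     (u^-1 * expR (- (b * u)) * (x * sin (z * u) + y * (1 - cos (z * u))))) =
   x * atan (z / b) + y * (ln (1 + (z / b) ^+ 2) / 2))%R.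
Proof.
move=> b0; pose K : R := `|z| * (`|x| + `|y|).
pose f (p : R * R) : R := \1_`]0, +oo[ p.1 * expR (- (b * p.1)) *
  (\1_`[0, 1] p.2 * (z * (x * cos (p.2 * z * p.1) + y * sin (p.2 * z * p.1)))).
have i1 : mu.-integrable setT (EFin \o (fun u : R => \1_`]0, +oo[ u * expR (-
  (b * u)))).
  by have [] := integral_expR_halfline b0.
have i2 : mu.-integrable setT (EFin \o (fun s : R => K * \1_`[0, 1] s)).
  exact: integrableZl (integrable_indic_segment ltr01).
have mf : measurable_fun setT f.
  apply: measurable_funM.
    apply: measurable_funM.
      exact: measurable_comp (measurable_indic_itv _) measurable_fst.
    apply: measurable_comp (@measurable_expR R) _.
    by apply: measurable_funN; exact: measurable_funM.
  have mpz : measurable_fun setT (fun p : R * R => p.2 * z * p.1).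
    by apply: measurable_funM => //; exact: measurable_funM.
  apply: measurable_funM.
    exact: measurable_comp (measurable_indic_itv _) measurable_snd.
  apply: measurable_funM => //; apply: measurable_funD; apply: measurable_funM => //.
    exact: measurable_comp (@measurable_cos R) mpz.
  exact: measurable_comp (@measurable_sin R) mpz.
have fK u s : `|f (u, s)| <= \1_`]0, +oo[ u * expR (- (b * u)) * (K * \1_`[0, 1] s).
  rewrite /f /= normrM (ger0_norm (mulr_ge0 _ (expR_ge0 _))) ?indicE//.
  rewrite ler_wpM2l ?mulr_ge0 ?expR_ge0//.
  rewrite normrM (ger0_norm (ler0n _ _)) [leRHS]mulrC ler_wpM2l// normrM ler_wpM2l//.
  by rewrite (le_trans (ler_normD _ _))// !normrM lerD// ler_piMr// ?cos_max ?sin_max.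
have inner (u : R) : (\int[mu]_s f (u, s))%R = \1_`]0, +oo[ u *
    (u^-1 * expR (- (b * u)) * (x * sin (z * u) + y * (1 - cos (z * u)))).
  rewrite /f /= indic_itvE in_itv/= andbT.
  have [u0|u0] := boolP (0 < u); last first.
    rewrite [RHS]mul0r.
    by under eq_lebesgue do rewrite !mul0r; rewrite Rintegral_cst// mul0r.
  have u0' : u != 0 by rewrite gt_eqF.
  have dt (s : R) : is_derive s 1 (fun s => s * z * u) (z * u).
    apply: is_derive_eq (isd_mul (isd_mul (isd_id s) (isd_cst z s)) (isd_cst u s)) _.
    by ring.
  have [||i e] := @integral_segment R
    (fun s => z * (x * cos (s * z * u) + y * sin (s * z * u)))
    (fun s => u^-1 * (x * sin (s * z * u) + (- y) * cos (s * z * u))) 0 1 ltr01.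
  - move=> s _.
    have ds := isd_scale y (isd_comp (is_derive_sin _) (dt s)).
    have dc := isd_scale x (isd_comp (is_derive_cos _) (dt s)).
    exact: isd_continuous (isd_scale z (isd_add dc ds)).
  - move=> s _.
    have ds := isd_scale x (isd_comp (is_derive_sin _) (dt s)).
    have dc := isd_scale (- y) (isd_comp (is_derive_cos _) (dt s)).
    by apply: is_derive_eq (isd_scale u^-1 (isd_add ds dc)) _; field.
  rewrite RintegralZl// e mul1r !mul0r !mul1r sin0 cos0; ring.
have outer (s : R) : (\int[mu]_u f (u, s))%R = \1_`[0, 1] s *
    (z * (x * b + y * (s * z)) / (b ^+ 2 + (s * z) ^+ 2)).
  have [i e] := laplace_trig (s * z) x y b0.
  have E (u : R) : f (u, s) = (\1_`[0, 1] s * z) * (\1_`]0, +oo[ u *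
      (expR (- (b * u)) * (x * cos (s * z * u) + y * sin (s * z * u)))).
    by rewrite /f/=; ring.
  by rewrite (eq_lebesgue E) RintegralZl// e !mulrA.
have := @integrable_dominated_slice _ _ _ _ R mu mu f _ _ mf i1 i2 fK.
have := @Rintegral_exchange _ _ _ _ R mu mu f _ _ mf i1 i2 fK.
rewrite (eq_lebesgue inner) (eq_lebesgue outer) => -> ii.
split; first by apply: eq_integrable_lebesgue ii.
have p0 (s : R) : 0 < 1 + (s * (z / b)) ^+ 2 by rewrite ltr_pwDl// sqr_ge0.
have pb (s : R) : b ^+ 2 + (s * z) ^+ 2 != 0.
  by rewrite gt_eqF// ltr_pwDl ?exprn_gt0// sqr_ge0.
have dt (s : R) : is_derive s 1 (fun s => s * (z / b)) (z / b).
  by apply: is_derive_eq (isd_mul (isd_id s) (isd_cst (z / b) s)) _; ring.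
have [||i e] := @integral_segment R
    (fun s => z * (x * b + y * (s * z)) / (b ^+ 2 + (s * z) ^+ 2))
    (fun s => x * atan (s * (z / b)) + (y / 2) * ln (1 + (s * (z / b)) ^+ 2)) 0 1 ltr01.
- move=> s _.
  apply: cvgM; [|apply: cvgV => //].
  + have dd := isd_scale z (isd_add (isd_cst (x * b) s) (isd_scale y (isd_mul
    (isd_id s) (isd_cst z s)))).
    exact: isd_continuous dd.
  + have dd := isd_add (isd_cst (b ^+ 2) s) (isd_mul (isd_mul (isd_id s)
    (isd_cst z s)) (isd_mul (isd_id s) (isd_cst z s))).
    exact: isd_continuous dd.
- move=> s _.
  have da := isd_scale x (isd_comp (is_derive1_atan _) (dt s)).
  have dq : is_derive s 1 (fun s : R => 1 + (s * (z / b)) ^+ 2) (2 * (s * (z / b)) *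
    (z / b)).
    by apply: is_derive_eq (isd_add (isd_cst 1 s) (isd_mul (dt s) (dt s))) _; ring.
  have dl := isd_scale (y / 2) (isd_comp (f := fun s => 1 + (s * (z / b)) ^+ 2)
    (is_derive1_ln (p0 s)) dq).
  apply: is_derive_eq (isd_add da dl) _.
  have := pb s; have := p0 s => /lt0r_neq0; rewrite !expr2 => h1 h2.
  field.
  by rewrite h2 gt_eqF.
rewrite e mul1r !mul0r atan0 expr0n/= addr0 ln1; ring.
Qed.

(** * The absolute value as a cosine integral *)

Lemma normr_sin_le (R : realType) (x : R) : `|sin x| <= `|x|.
Proof.
wlog x0 : x / 0 <= x.
  move=> H; have [/H//|x0] := leP 0 x.
  by have := H (- x); rewrite sinN !normrN; apply; rewrite oppr_ge0 ltW.
have [|c _] := @MVT_segment R sin cos 0 x x0 (fun y _ => is_derive_sin y).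
  by apply: continuous_subspaceT; exact: continuous_sin.
by rewrite sin0 !subr0 => ->; rewrite normrM ler_piMl// cos_max.
Qed.

Lemma cos_half (R : realType) (x : R) : 1 - cos x = 2 * sin (x / 2) ^+ 2.
Proof.
have H := cos2Dsin2 (x / 2); rewrite {1}[x]splitr cosD.
by rewrite -{1}H; ring.
Qed.

Lemma onem_cos_le (R : realType) (x : R) : 0 <= 1 - cos x <= x ^+ 2 / 2.
Proof.
rewrite cos_half mulr_ge0 ?sqr_ge0//=.
have : sin (x / 2) ^+ 2 <= (x / 2) ^+ 2.
  by rewrite -[leLHS]real_normK ?num_real// -[leRHS]real_normK ?num_real// ler_sqr
    ?nnegrE//; exact: normr_sin_le.
by move=> H; lra.
Qed.

Lemma integrable_cauchy (R : realType) :
  mu.-integrable setT (EFin \o (fun z : R => \1_`]0, +oo[ z * (1 + z ^+ 2)^-1)).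
Proof.
have p0 (z : R) : 1 + z ^+ 2 != 0 by rewrite gt_eqF// ltr_pwDl// sqr_ge0.
have [] // := @ge0_integral_halfline R (fun z => (1 + z ^+ 2)^-1) atan 0 (pi / 2).
- by move=> z _; rewrite invr_ge0 addr_ge0// sqr_ge0.
- move=> z _; apply: cvgV => //.
  exact: (isd_continuous (isd_add (isd_cst 1 z) (isd_mul (isd_id z) (isd_id z)))).
- exact: cvgy_atan.
Qed.

Lemma inv_square_tail (R : realType) (M : R) : 0 < M ->
  mu.-integrable setT (EFin \o (fun z : R => \1_`]M, +oo[ z * (z ^+ 2)^-1)) /\
  (\int[mu]_z (\1_`]M, +oo[ z * (z ^+ 2)^-1) = M^-1)%R.
Proof.
move=> M0.
have z0 (z : R) : M <= z -> z != 0 by move=> Mz; rewrite gt_eqF// (lt_le_trans M0).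
have := @ge0_integral_halfline R (fun z => (z ^+ 2)^-1) (fun z => - z^-1) M 0.
rewrite sub0r opprK; apply.
- by move=> z _; rewrite invr_ge0 sqr_ge0.
- move=> z /z0 zn; apply: cvgV; first by rewrite sqrf_eq0.
  exact: (isd_continuous (isd_mul (isd_id z) (isd_id z))).
- move=> z /z0 zn.
  have := isd_scale (-1) (is_deriveV zn (isd_id z)).
  under eq_fun do rewrite mulN1r.
  by move=> H; apply: is_derive_eq H _; rewrite /GRing.scale/=; field.
- rewrite -oppr0; apply: cvgN.
  apply/(@gtr0_cvgV0 _ _ _ _ (fun x : R => x)); last exact: cvg_id.
  by near=> x; near: x; exact: nbhs_pinfty_gt.
Unshelve. all: by end_near.
Qed.

Definition tent_weight (R : realType) (v z : R) : R :=
  \1_`]0, +oo[ z * ((z ^+ 2)^-1 * (1 - cos (z * v))).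

Definition tent_const (R : realType) : R := (\int[mu]_z tent_weight 1 z)%R.

Lemma measurable_tent_weight (R : realType) (v : R) :
  measurable_fun setT (tent_weight v).
Proof.
apply: measurable_funM; first exact: measurable_indic_itv.
apply: measurable_funM.
  apply: measurable_comp (@measurable_inv R) _; exact: measurable_funX.
apply: measurable_funB => //; apply: measurable_comp (@measurable_cos R) _.
exact: measurable_funM.
Qed.

Lemma integrable_tent_weight (R : realType) (v : R) :
  mu.-integrable setT (EFin \o (tent_weight v)).
Proof.
have i := integrableZl measurableT (v ^+ 2 / 2 + 2) (@integrable_cauchy R).
apply: (@integrable_of_le _ _ _ mu _ (fun z : R => (v ^+ 2 / 2 + 2) *
  (\1_`]0, +oo[ z * (1 + z ^+ 2)^-1)) (measurable_tent_weight v) _ i) => z.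
rewrite /tent_weight indic_itvE in_itv/= andbT.
have [z0|z0] := boolP (0 < z); last by rewrite !mul0r mulr0 normr0.
rewrite !mul1r.
have /andP[c0 c1] := onem_cos_le (z * v).
have c2 : 1 - cos (z * v) <= 2 by have := cos_geN1 (z * v); lra.
rewrite ger0_norm ?mulr_ge0 ?invr_ge0 ?sqr_ge0//.
have p0 : 0 < 1 + z ^+ 2 by rewrite ltr_pwDl// sqr_ge0.
rewrite ler_pdivlMr// -mulrA ler_pdivrMl ?exprn_gt0//.
have -> : z ^+ 2 * (v ^+ 2 / 2 + 2) = (z * v) ^+ 2 / 2 + z ^+ 2 * 2 by ring.
by rewrite mulrDr mulr1 lerD// [leLHS]mulrC ler_wpM2l// sqr_ge0.
Qed.

(** By scaling, the integral is homogeneous of degree one in [v], hence a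
    multiple of [|v|]. *)
Lemma integral_tent_weight (R : realType) (v : R) :
  (\int[mu]_z tent_weight v z)%R = tent_const R * `|v|.
Proof.
have [->|v0] := eqVneq v 0.
  rewrite normr0 mulr0.
  have E (z : R) : tent_weight 0 z = 0 by rewrite /tent_weight mulr0 cos0 subrr !mulr0.
  by rewrite (eq_lebesgue E) Rintegral_cst// mul0r.
have nv : `|v| != 0 by rewrite normr_eq0.
have nvp : 0 < `|v| by rewrite normr_gt0.
rewrite /tent_const (Rintegral_scale nv (@integrable_tent_weight R 1)) normr_id.
have E (z : R) : tent_weight 1 (`|v| * z) = (`|v| ^+ 2)^-1 * tent_weight v z.
  rewrite /tent_weight !indic_itvE !in_itv/= !andbT mulr1 pmulr_rgt0//.
  rewrite exprMn invfM.
  suff -> : cos (`|v| * z) = cos (z * v) by ring.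
  have [v1|v1] := leP 0 v; first by rewrite ger0_norm// mulrC.
  by rewrite ltr0_norm// mulNr cosN mulrC.
rewrite (eq_lebesgue E) RintegralZl//; last exact: integrable_tent_weight.
by field.
Qed.

(** Between [pi / 2] and [pi] the cosine is nonpositive, so the weight is at
    least [pi^-2] there. *)
Lemma tent_const_gt0 (R : realType) : 0 < tent_const R.
Proof.
have pi2 := @pi_gt0 R.
have ab : pi / 2 < pi :> R by lra.
have i := integrableZl measurableT (pi ^- 2) (integrable_indic_segment ab).
apply: (@lt_le_trans _ _ (\int[mu]_z (pi ^- 2 * \1_`[pi / 2, pi] z))%R).
  rewrite RintegralZl//; last exact: integrable_indic_segment.
  have [_] := @integral_segment R (fun=> 1) (fun x => x) _ _ ab
    (fun x _ => isd_continuous (isd_cst 1 x)) (fun x _ => isd_id x).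
  have E (z : R) : \1_`[pi / 2, pi] z = \1_`[pi / 2, pi] z * 1 :> R by rewrite mulr1.
  by rewrite (eq_lebesgue E) => ->; rewrite mulr_gt0 ?invr_gt0 ?exprn_gt0//; lra.
apply: le_Rintegral => //; first exact: integrable_tent_weight.
move=> z _; rewrite /tent_weight !indic_itvE !in_itv/= andbT mulr1.
have [/andP[z1 z2]|_] := boolP (pi / 2 <= z <= pi); last first.
  by rewrite mulr0 !mulr_ge0 ?ler0n// ?invr_ge0 ?sqr_ge0 ?subr_ge0 ?cos_le1.
have z0 : 0 < z by lra.
rewrite z0 mulr1 mul1r.
have cz : cos z <= 0.
  have := @cos_ge0_pihalf R (pi - z); rewrite cosB cospi sinpi; lra.
rewrite -[leLHS]mulr1 ler_pM ?invr_ge0 ?sqr_ge0//; last lra.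
by rewrite lef_pV2 ?posrE ?exprn_gt0// ler_sqr ?nnegrE// ltW.
Qed.

(** * Cosine and sine transforms of a probability *)

Lemma lipschitz_of_derive (R : realType) (f df : R -> R) (x y : R) :
  (forall t : R, is_derive t 1 f (df t)) -> (forall t, `|df t| <= 1) ->
  `|f x - f y| <= `|x - y|.
Proof.
move=> dfx df1.
wlog xy : x y / y <= x.
  by move=> H; have [/H//|/ltW/H] := leP y x; rewrite distrC => /le_trans; apply;
    rewrite distrC.
have [|c _ ->] := @MVT_segment R f df y x xy (fun t _ => dfx t).
  by apply: continuous_subspaceT => t; exact: isd_continuous (dfx t).
by rewrite normrM ler_piMl.
Qed.

Lemma sin_lipschitz (R : realType) (x y : R) : `|sin x - sin y| <= `|x - y|.
Proof.
by apply: (lipschitz_of_derive x y (@is_derive_sin R)) => t; exact: cos_max.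
Qed.

Lemma cos_lipschitz (R : realType) (x y : R) : `|cos x - cos y| <= `|x - y|.
Proof.
by apply: (lipschitz_of_derive x y (@is_derive_cos R)) => t; rewrite normrN sin_max.
Qed.

Lemma integrable_bounded d (T : measurableType d) (R : realType)
    (P : probability T R) (f : T -> R) (M : R) :
  measurable_fun setT f -> (forall x, `|f x| <= M) ->
  P.-integrable setT (EFin \o f).
Proof.
move=> mf fM; apply: (@integrable_of_le _ _ _ P f (fun=> M)) => //.
exact: finite_measure_integrable_cst.
Qed.

Definition cos_transform (R : realType) (P : probability R R) (z : R) : R :=
  (\int[P]_u cos (z * u))%R.

Definition sin_transform (R : realType) (P : probability R R) (z : R) : R :=
  (\int[P]_u sin (z * u))%R.

Section Transforms.
Context {R : realType} (P : probability R R).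

Lemma integrable_cos (z : R) : P.-integrable setT (EFin \o (fun u => cos (z * u))).
Proof.
apply: (@integrable_bounded _ _ _ _ _ 1) => [|u]; last exact: cos_max.
by apply: measurable_comp (@measurable_cos R) _; exact: measurable_funM.
Qed.

Lemma integrable_sin (z : R) : P.-integrable setT (EFin \o (fun u => sin (z * u))).
Proof.
apply: (@integrable_bounded _ _ _ _ _ 1) => [|u]; last exact: sin_max.
by apply: measurable_comp (@measurable_sin R) _; exact: measurable_funM.
Qed.

Lemma Rintegral_probability_cst (c : R) : (\int[P]_u c)%R = c.
Proof. by rewrite Rintegral_cst// /= probability_setT/= mulr1. Qed.

Lemma integral_trig_comb (x y z : R) :
  (\int[P]_u (x * cos (z * u) + y * sin (z * u)))%R =
  x * cos_transform P z + y * sin_transform P z.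
Proof.
have ic := integrableZl measurableT x (integrable_cos z).
have js := integrableZl measurableT y (integrable_sin z).
rewrite RintegralD// !RintegralZl//; first exact: integrable_sin.
exact: integrable_cos.
Qed.

Lemma norm_integral_le (f : R -> R) (M : R) : measurable_fun setT f ->
  (forall x, `|f x| <= M) -> `|(\int[P]_u f u)%R| <= M.
Proof.
move=> mf fM; have fi := integrable_bounded P mf fM.
apply: (le_trans (le_normr_Rintegral measurableT fi)).
rewrite -[leRHS]Rintegral_probability_cst.
apply: le_Rintegral => //; first exact: integrable_norm.
exact: finite_measure_integrable_cst.
Qed.

Lemma cos_transform_le1 (z : R) : `|cos_transform P z| <= 1.
Proof.
apply: norm_integral_le => [|u]; last exact: cos_max.
by apply: measurable_comp (@measurable_cos R) _; exact: measurable_funM.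
Qed.

Lemma sin_transform_le1 (z : R) : `|sin_transform P z| <= 1.
Proof.
apply: norm_integral_le => [|u]; last exact: sin_max.
by apply: measurable_comp (@measurable_sin R) _; exact: measurable_funM.
Qed.

End Transforms.

(** * The trapezoid and its Fourier representation *)

(** Equal to [1] from [a] to [b], to [0] outside [a - e] to [b + e], and affine in
    between; as a combination of absolute values it has a cosine
    representation. *)
Definition trapezoid (R : realType) (a b e u : R) : R :=
  (`|u - (a - e)| - `|u - a| - `|u - b| + `|u - (b + e)|) / (2 * e).

(** The four absolute values of the trapezoid, each replaced by the integrand of
    its cosine representation; the constant terms cancel. *)
Definition trapezoid_kernel (R : realType) (a b e z u : R) : R :=
  \1_`]0, +oo[ z * ((z ^+ 2)^-1 *
    (cos (z * (u - a)) - cos (z * (u - (a - e)))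
     + cos (z * (u - b)) - cos (z * (u - (b + e))))).

Section Trapezoid.
Context {R : realType} (a b e : R).
Hypotheses (ab : a <= b) (e0 : 0 < e).

Let trapezoid_numerator u :
  let N := `|u - (a - e)| - `|u - a| - `|u - b| + `|u - (b + e)| in
  [/\ 0 <= N, N <= 2 * e, a <= u <= b -> N = 2 * e & b + e < u -> N = 0].
Proof.
have [ab' e0'] := (ab, e0).
rewrite /=; case: (ger0P (u - (a - e))) => ?; case: (ger0P (u - a)) => ?;
  case: (ger0P (u - b)) => ?; case: (ger0P (u - (b + e))) => ?;
  by split; [lra|lra|move=> /andP[]; lra|lra].
Qed.

Lemma trapezoid_ge0 u : 0 <= trapezoid a b e u.
Proof.
have [N0 _ _ _] := trapezoid_numerator u.
by rewrite divr_ge0// mulr_ge0// ltW.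
Qed.

Lemma trapezoid_le1 u : trapezoid a b e u <= 1.
Proof.
have [_ N1 _ _] := trapezoid_numerator u.
by rewrite ler_pdivrMr ?mulr_gt0// mul1r.
Qed.

Lemma trapezoid_eq1 u : a <= u <= b -> trapezoid a b e u = 1.
Proof.
have [_ _ N1 _] := trapezoid_numerator u => /N1 E.
by rewrite /trapezoid E divff// mulf_neq0 ?gt_eqF.
Qed.

Lemma trapezoid_eq0 u : b + e < u -> trapezoid a b e u = 0.
Proof.
by have [_ _ _ N0] := trapezoid_numerator u => /N0 E; rewrite /trapezoid E mul0r.
Qed.

Lemma measurable_trapezoid : measurable_fun setT (trapezoid a b e).
Proof.
apply: measurable_funM => //; apply: measurable_funD => //.
  apply: measurable_funB => //; first apply: measurable_funB => //.
  - by apply: measurableT_comp => //; exact: measurable_funB.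
  - by apply: measurableT_comp => //; exact: measurable_funB.
  - by apply: measurableT_comp => //; exact: measurable_funB.
by apply: measurableT_comp => //; exact: measurable_funB.
Qed.

Lemma integral_trapezoid_kernel u :
  (\int[mu]_z trapezoid_kernel a b e z u)%R = tent_const R *
    (2 * e) * trapezoid a b e u.
Proof.
have it v := @integrable_tent_weight R v.
have E z : trapezoid_kernel a b e z u =
    (tent_weight (u - (a - e)) z - tent_weight (u - a) z)
    + (tent_weight (u - (b + e)) z - tent_weight (u - b) z).
  by rewrite /trapezoid_kernel /tent_weight; ring.
have i1 := integrableB measurableT (it (u - (a - e))) (it (u - a)).
have i2 := integrableB measurableT (it (u - (b + e))) (it (u - b)).
rewrite (eq_lebesgue E) RintegralD// !RintegralB// !integral_tent_weight.
rewrite /trapezoid; field.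
by rewrite gt_eqF.
Qed.

(** Near [z = 0] the four cosines cancel to second order, uniformly in [u];
    this is what the two-sided trapezoid has over a one-sided ramp, for which
    exchanging the integrals would require a moment. *)
Lemma trapezoid_kernel_le z u : `|trapezoid_kernel a b e z u| <=
  (e * (b - a + e) + 4) * (\1_`]0, +oo[ z * (1 + z ^+ 2)^-1).
Proof.
rewrite /trapezoid_kernel indic_itvE in_itv/= andbT.
have [z0|z0] := boolP (0 < z); last by rewrite !mul0r mulr0 normr0.
rewrite !mul1r normrM ger0_norm ?invr_ge0 ?sqr_ge0//.
set N := `| _ |.
have N4 : N <= 4.
  rewrite /N ler_norml.
  have := cos_geN1 (z * (u - a)); have := cos_le1 (z * (u - a)).
  have := cos_geN1 (z * (u - b)); have := cos_le1 (z * (u - b)).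
  have := cos_geN1 (z * (u - (a - e))); have := cos_le1 (z * (u - (a - e))).
  have := cos_geN1 (z * (u - (b + e))); have := cos_le1 (z * (u - (b + e))).
  by lra.
have N2 : N <= z ^+ 2 * (e * (b - a + e)).
  pose X := z * (u - a + e / 2); pose Y := z * (u - b - e / 2); pose h := z * e / 2.
  have -> : N = `|2 * sin h * (sin X - sin Y)|.
    rewrite /N.
    have -> : z * (u - a) = X - h by rewrite /X /h; field.
    have -> : z * (u - (a - e)) = X + h by rewrite /X /h; field.
    have -> : z * (u - b) = Y + h by rewrite /Y /h; field.
    have -> : z * (u - (b + e)) = Y - h by rewrite /Y /h; field.
    by rewrite !cosB !cosD; congr `|_|; ring.
  rewrite !normrM.
  have -> : z ^+ 2 * (e * (b - a + e)) = 2 * h * (X - Y) by rewrite /X /Y /h; field.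
  have h0 : 0 <= h by rewrite /h !mulr_ge0// ltW.
  have XY : 0 <= X - Y.
    by rewrite /X /Y -mulrBr mulr_ge0 ?ltW//; have [ab' e0'] := (ab, e0); lra.
  rewrite ler_pM ?mulr_ge0//; last by rewrite -[leRHS]ger0_norm// sin_lipschitz.
  by rewrite ger0_norm// ler_wpM2l// -[leRHS]ger0_norm// normr_sin_le.
have p0 : 0 < 1 + z ^+ 2 by rewrite ltr_pwDl// sqr_ge0.
rewrite ler_pdivlMr// -mulrA ler_pdivrMl ?exprn_gt0//.
by rewrite mulrDr mulr1 mulrDr lerD// [leLHS]mulrC ler_wpM2l// sqr_ge0.
Qed.

Lemma measurable_trapezoid_kernel :
  measurable_fun setT (fun p : R * R => trapezoid_kernel a b e p.1 p.2).
Proof.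
have m c : measurable_fun setT (fun p : R * R => cos (p.1 * (p.2 - c))).
  apply: measurable_comp (@measurable_cos R) _; apply: measurable_funM => //.
  exact: measurable_funB.
apply: measurable_funM;
  first exact: measurable_comp (measurable_indic_itv _) measurable_fst.
apply: measurable_funM.
  by apply: measurable_comp (@measurable_inv R) _; exact: measurable_funX.
apply: measurable_funB; last exact: m.
apply: measurable_funD; last exact: m.
by apply: measurable_funB; exact: m.
Qed.

(** The expectation of [trapezoid_kernel] under [P], expressed through the
    transforms of [P]. *)
Definition trapezoid_fourier (P : probability R R) z : R :=
  \1_`]0, +oo[ z * ((z ^+ 2)^-1 *
   ((cos (z * a) - cos (z * (a - e)) + (cos (z * b) - cos (z *
     (b + e)))) * cos_transform P z +
    (sin (z * a) - sin (z * (a - e)) + (sin (z * b) - sin (z *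
      (b + e)))) * sin_transform P z)).

Lemma integral_trapezoid (P : probability R R) :
  mu.-integrable setT (EFin \o trapezoid_fourier P) /\
  tent_const R * (2 * e) * (\int[P]_u trapezoid a b e u)%R =
  (\int[mu]_z trapezoid_fourier P z)%R.
Proof.
have ih : mu.-integrable setT (EFin \o (fun z : R => (e * (b - a + e) + 4) *
    (\1_`]0, +oo[ z * (1 + z ^+ 2)^-1))).
  exact: integrableZl (@integrable_cauchy R).
have i1 : P.-integrable setT (EFin \o (fun=> 1 : R)).
  exact: finite_measure_integrable_cst.
pose f (p : R * R) := trapezoid_kernel a b e p.1 p.2.
have fle z u : `|f (z, u)| <= (e * (b - a + e) + 4) *
    (\1_`]0, +oo[ z * (1 + z ^+ 2)^-1) * 1.
  by rewrite mulr1; exact: trapezoid_kernel_le.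
have J z : (\int[P]_u f (z, u))%R = trapezoid_fourier P z.
  pose k := \1_`]0, +oo[ z * (z ^+ 2)^-1.
  pose x := cos (z * a) - cos (z * (a - e)) + (cos (z * b) - cos (z * (b + e))).
  pose y := sin (z * a) - sin (z * (a - e)) + (sin (z * b) - sin (z * (b + e))).
  transitivity (\int[P]_u ((k * x) * cos (z * u) + (k * y) * sin (z * u)))%R.
    apply: eq_Rintegral => u _.
    have c v : cos (z * (u - v)) = cos (z * u) * cos (z * v) + sin (z * u) * sin
      (z * v).
      by rewrite mulrBr cosB.
    by rewrite /f /trapezoid_kernel /= !c /k /x /y; ring.
  by rewrite integral_trig_comb /trapezoid_fourier /k /x /y; ring.
have := @integrable_dominated_slice _ _ _ _ R mu P f _ _ measurable_trapezoid_kernel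
  ih i1 fle.
have := @Rintegral_exchange _ _ _ _ R mu P f _ _ measurable_trapezoid_kernel ih i1 fle.
rewrite (eq_lebesgue J) => -> ii; split.
  by apply: eq_integrable_lebesgue ii => z; rewrite J.
rewrite -RintegralZl//; last first.
  apply: (@integrable_bounded _ _ _ _ _ 1) => [|u]; first exact: measurable_trapezoid.
  by rewrite ger0_norm ?trapezoid_ge0// trapezoid_le1.
by apply: eq_Rintegral => u _; rewrite -integral_trapezoid_kernel.
Qed.

End Trapezoid.

(** * Smoothing inequality and concentration *)

(** The factor [z ^+ 2 / (1 + z ^+ 2)] makes the integrand
    [z / (1 + z ^+ 2)] up to [M]; beyond [M] the trivial bound on the
    transforms is integrated against [z ^- 2]. *)
Lemma smoothing_inequality (R : realType) (P Q : probability R R)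
    (a b e M eta : R) : a <= b -> 0 < e -> 0 < M -> 0 <= eta ->
  (forall z, 0 < z <= M ->
     `|cos_transform P z - cos_transform Q z| + `|sin_transform P z - sin_transform Q z|
       <= eta * (z ^+ 2 / (1 + z ^+ 2))) ->
  `|(\int[P]_u trapezoid a b e u)%R - (\int[Q]_u trapezoid a b e u)%R| <=
   (tent_const R)^-1 * (eta / 2 * ln (1 + M ^+ 2) + 8 / (e * M)).
Proof.
move=> ab e0 M0 eta0 PQ.
have [iP eP] := integral_trapezoid ab e0 P.
have [iQ eQ] := integral_trapezoid ab e0 Q.
have c0 := tent_const_gt0 R.
have ce0 : 0 < tent_const R * (2 * e) by rewrite !mulr_gt0.
have p0 (z : R) : 0 < 1 + z ^+ 2 by rewrite ltr_pwDl// sqr_ge0.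
rewrite -(ler_pM2l ce0) -[X in X * `| _ |](gtr0_norm ce0) -normrM mulrBr eP eQ.
rewrite -RintegralB//.
have [im em] := inv_square_tail M0.
have [||il el] := @integral_segment R (fun z => z / (1 + z ^+ 2))
    (fun z => 2^-1 * ln (1 + z ^+ 2)) 0 M M0.
- move=> z _; apply: cvgM; first exact: cvg_id.
  apply: cvgV; first by rewrite gt_eqF.
  exact: (isd_continuous (isd_add (isd_cst 1 z) (isd_mul (isd_id z) (isd_id z)))).
- move=> z _.
  have dq : is_derive z 1 (fun z : R => 1 + z ^+ 2) (2 * z).
    by apply: is_derive_eq (isd_add (isd_cst 1 z) (isd_mul (isd_id z) (isd_id z))) _;
      ring.
  have dl := isd_scale 2^-1 (isd_comp (f := fun z => 1 + z ^+ 2) (is_derive1_ln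
    (p0 z)) dq).
  by apply: is_derive_eq dl _; field; rewrite gt_eqF.
have il' := integrableZl measurableT (2 * e * eta) il.
have im' := integrableZl measurableT 16 im.
pose g (z : R) := 2 * e * eta * (\1_`[0, M] z * (z / (1 + z ^+ 2)))
  + 16 * (\1_`]M, +oo[ z * (z ^+ 2)^-1).
have ig : mu.-integrable setT (EFin \o g) by exact: (integrableD measurableT il' im').
have -> : tent_const R * (2 * e) *
    ((tent_const R)^-1 * (eta / 2 * ln (1 + M ^+ 2) + 8 / (e * M))) =
    (\int[mu]_z g z)%R.
  rewrite RintegralD// !RintegralZl// el em expr0n/= addr0 ln1.
  by field; rewrite !gt_eqF.
have iD := integrableB measurableT iP iQ.
apply: (le_trans (le_normr_Rintegral measurableT iD)).
apply: le_Rintegral => //; first exact: integrable_norm.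
move=> z _.
rewrite /trapezoid_fourier /g !indic_itvE !in_itv/= !andbT.
have [z0|z0] := boolP (0 < z); last first.
  rewrite !mul0r subrr normr0; apply: addr_ge0; apply: mulr_ge0 => //.
  - by rewrite !mulr_ge0// ltW.
  - have [/andP[z1 _]|_] := boolP (0 <= z <= M); last by rewrite mul0r.
    by rewrite mul1r mulr_ge0// invr_ge0 ltW.
  - by rewrite mulr_ge0 ?invr_ge0 ?sqr_ge0.
rewrite !mul1r -mulrBr normrM ger0_norm ?invr_ge0 ?sqr_ge0// (ltW z0)/=.
set A := cos (z * a) - cos (z * (a - e)) + _.
set B := sin (z * a) - sin (z * (a - e)) + _.
set C := cos_transform P z; set C' := cos_transform Q z.
set S := sin_transform P z; set S' := sin_transform Q z.
have -> : A * C + B * S - (A * C' + B * S') = A * (C - C') + B * (S - S') by ring.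
have zxy x y : `|z * x - z * y| = z * `|x - y| by rewrite -mulrBr normrM gtr0_norm.
have se (x y : R) : `|x - y| = e -> `|z * x - z * y| <= z * e by rewrite zxy => ->.
have aE : `|a - (a - e)| = e by rewrite opprB addrC subrK gtr0_norm.
have bE : `|b - (b + e)| = e by rewrite opprD addrA subrr sub0r normrN gtr0_norm.
have tri (x y m : R) : `|x| <= m -> `|y| <= m -> `|x + y| <= 2 * m.
  by move=> xm ym; rewrite (le_trans (ler_normD _ _))// mulr_natl mulr2n lerD.
have A1 : `|A| <= 2 * (z * e).
  by apply: tri; apply: (le_trans (cos_lipschitz _ _)); exact: se.
have B1 : `|B| <= 2 * (z * e).
  by apply: tri; apply: (le_trans (sin_lipschitz _ _)); exact: se.
have A2 : `|A| <= 4.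
  have -> : 4 = 2 * (2 * 1) :> R by ring.
  by apply: (tri _ _ (2 * 1)); apply: (tri _ _ 1); rewrite ?normrN cos_max.
have B2 : `|B| <= 4.
  have -> : 4 = 2 * (2 * 1) :> R by ring.
  by apply: (tri _ _ (2 * 1)); apply: (tri _ _ 1); rewrite ?normrN sin_max.
have AB m : `|A| <= m -> `|B| <= m ->
    `|A * (C - C') + B * (S - S')| <= m * (`|C - C'| + `|S - S'|).
  by move=> Am Bm; rewrite (le_trans (ler_normD _ _))// !normrM mulrDr lerD// ler_wpM2r.
have [zM|zM] := leP z M.
  rewrite mulr0n mul0r mulr0 addr0 mul1r ler_pdivrMl ?exprn_gt0//.
  apply: (le_trans (AB _ A1 B1)).
  have -> : z ^+ 2 * (2 * e * eta * (z / (1 + z ^+ 2))) =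
     2 * (z * e) * (eta * (z ^+ 2 / (1 + z ^+ 2))) by field; rewrite gt_eqF.
  apply: ler_wpM2l; first by rewrite !mulr_ge0// ltW.
  by apply: PQ; rewrite z0.
rewrite mul0r mulr0 add0r mul1r ler_pdivrMl ?exprn_gt0//.
apply: (le_trans (AB _ A2 B2)).
have -> : z ^+ 2 * (16 / z ^+ 2) = 4 * (2 * 1 + 2 * 1) by field; rewrite gt_eqF.
rewrite ler_wpM2l// lerD// tri// ?normrN ?cos_transform_le1 ?sin_transform_le1//.
Qed.

Lemma Rintegral_indic (R : realType) (P : probability R R) (A : set R) :
  measurable A -> (\int[P]_u \1_A u)%R = fine (P A).
Proof. by move=> mA; rewrite /Rintegral integral_indic// setIT. Qed.

Lemma fine_probability_le_integral (R : realType) (P : probability R R)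
    (A : set R) (f : R -> R) : measurable A -> P.-integrable setT (EFin \o f) ->
  (forall u, \1_A u <= f u) -> fine (P A) <= (\int[P]_u f u)%R.
Proof.
move=> mA fi Af; rewrite -Rintegral_indic//; apply: le_Rintegral => //.
exact: integrable_indic.
Qed.

Lemma integral_le_fine_probability (R : realType) (P : probability R R)
    (A : set R) (f : R -> R) : measurable A -> P.-integrable setT (EFin \o f) ->
  (forall u, f u <= \1_A u) -> (\int[P]_u f u)%R <= fine (P A).
Proof.
move=> mA fi Af; rewrite -Rintegral_indic//; apply: le_Rintegral => //.
exact: integrable_indic.
Qed.

(** Trapezoids see bounded intervals only; half-lines are reached by continuity
    from below. *)
Lemma probability_halfline_le (R : realType) (P : probability R R) (x B : R) :
  (forall a, a <= x -> fine (P `[a, x]%classic) <= B) -> fine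
    (P `]-oo, x]%classic) <= B.
Proof.
move=> H; pose F (n : nat) : set R := `[x - n%:R, x]%classic.
have UF : \bigcup_n F n = `]-oo, x]%classic.
  apply/seteqP; split => y /=; first by move=> [n _]; rewrite /F/= !in_itv/= => /andP[].
  rewrite in_itv/= => yx.
  have [n /ltW nx] : exists n : nat, x - y < n%:R.
    exists (Num.truncn (x - y)).+1.
    by have := @truncnS_gt R (x - y).
  by exists n => //; rewrite /F/= in_itv/= yx andbT; lra.
have ndF : nondecreasing_seq F.
  move=> m n mn; apply/subsetPset => y; rewrite /F/= !in_itv/= => /andP[ay ->].
  rewrite andbT; apply: le_trans ay; rewrite lerB// ler_nat//.
have mF n : measurable (F n) by exact: measurable_itv.
have := @nondecreasing_cvg_mu _ _ _ P F mF _ ndF.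
rewrite UF => /(_ (measurable_itv _)) cF.
rewrite -lee_fin fineK ?fin_num_measure//.
rewrite -(cvg_lim _ cF)//; apply: lime_le; first by apply: cvgP cF.
apply: nearW => n /=; rewrite -[P (F n)]fineK ?fin_num_measure// lee_fin.
by apply: H; rewrite gerBl.
Qed.

(** For every [a], the trapezoid that is [1] from [a] to [x] and [0] beyond
    [x + e] lies between the indicators of the two sets. *)
Lemma cdf_smoothing (R : realType) (P Q : probability R R) (e M eta x : R) :
  0 < e -> 0 < M -> 0 <= eta ->
  (forall z, 0 < z <= M ->
     `|cos_transform P z - cos_transform Q z| + `|sin_transform P z - sin_transform Q z|
       <= eta * (z ^+ 2 / (1 + z ^+ 2))) ->
  fine (P `]-oo, x]%classic) <= fine (Q `]-oo, x + e]%classic) +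
   (tent_const R)^-1 * (eta / 2 * ln (1 + M ^+ 2) + 8 / (e * M)).
Proof.
move=> e0 M0 eta0 PQ; apply: probability_halfline_le => a ax.
have it (S : probability R R) : S.-integrable setT (EFin \o trapezoid a x e).
  apply: (@integrable_bounded _ _ _ _ _ 1) => [|u]; first exact: measurable_trapezoid.
  by rewrite ger0_norm ?trapezoid_ge0// trapezoid_le1.
have := smoothing_inequality ax e0 M0 eta0 PQ.
rewrite ler_norml => /andP[_ H].
apply: (@le_trans _ _ (\int[P]_u trapezoid a x e u)%R).
  apply: fine_probability_le_integral => // u; rewrite indic_itvE in_itv/=.
  have [/(trapezoid_eq1 ax e0)->//|_] := boolP (a <= u <= x).
  by rewrite trapezoid_ge0.
apply: (@le_trans _ _ ((\int[Q]_u trapezoid a x e u)%R +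
   (tent_const R)^-1 * (eta / 2 * ln (1 + M ^+ 2) + 8 / (e * M)))); first lra.
rewrite lerD2r; apply: integral_le_fine_probability => // u.
rewrite indic_itvE in_itv/=.
have [ux|xu] := leP u (x + e); first exact: trapezoid_le1.
by rewrite trapezoid_eq0.
Qed.

(** The Cauchy kernel [1 / (1 + u^2)] is at least [1 / 2] for [|u| <= 1] and
    is the Laplace transform of a cosine, so decay of the characteristic
    function bounds the mass of the interval without any inversion formula. *)
Lemma concentration_bound (R : realType) (P : probability R R) (x e Zc theta : R) :
  0 < e -> 0 < Zc -> 0 <= theta ->
  (forall z, Zc <= z -> `|cos_transform P z| <= theta /\ `|sin_transform P z| <=
    theta) ->
  fine (P `[x, x + e]%classic) <= 4 * (e * Zc) + 4 * theta.
Proof.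
move=> e0 Z0 th0 Pdec.
pose cauchy (u : R) : R := (1 + ((u - x) / e) ^+ 2)^-1.
have p0 u : 0 < 1 + ((u - x) / e) ^+ 2 by rewrite ltr_pwDl// sqr_ge0.
pose f (p : R * R) : R := \1_`]0, +oo[ p.1 *
  (expR (- (1 * p.1)) * (1 * cos ((p.2 - x) / e * p.1) + 0 * sin
    ((p.2 - x) / e * p.1))).
have inner u : (\int[mu]_t f (t, u))%R = cauchy u.
  have [_] := laplace_trig ((u - x) / e) 1 0 (@ltr01 R).
  by rewrite /f /= => ->; rewrite /cauchy expr1n mul0r addr0 !mul1r.
have [ie ee] := integral_expR_halfline (@ltr01 R).
have i1 : P.-integrable setT (EFin \o (fun=> 1 : R)).
  exact: finite_measure_integrable_cst.
have ge0 (t : R) : 0 <= \1_`]0, +oo[ t * expR (- (1 * t)).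
  by rewrite mulr_ge0 ?expR_ge0// indic_itvE.
have fle t u : `|f (t, u)| <= \1_`]0, +oo[ t * expR (- (1 * t)) * 1.
  rewrite /f /= mul0r addr0 [1 * cos _]mul1r mulrA normrM [X in X * _]ger0_norm//.
  by rewrite ler_wpM2l// cos_max.
have mq : measurable_fun setT (fun p : R * R => (p.2 - x) / e * p.1).
  apply: measurable_funM => //; apply: measurable_funM => //.
  exact: measurable_funB.
have mf : measurable_fun setT f.
  apply: measurable_funM;
    first exact: measurable_comp (measurable_indic_itv _) measurable_fst.
  apply: measurable_funM.
    apply: measurable_comp (@measurable_expR R) _.
    by apply: measurable_funN; exact: measurable_funM.
  apply: measurable_funD; apply: measurable_funM => //.
    exact: measurable_comp (@measurable_cos R) mq.
  exact: measurable_comp (@measurable_sin R) mq.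
have outer t : (\int[P]_u f (t, u))%R = \1_`]0, +oo[ t * (expR (- (1 * t)) *
    (cos (t / e * x) * cos_transform P (t / e) + sin (t / e * x) * sin_transform P
      (t / e))).
  pose k := \1_`]0, +oo[ t * expR (- (1 * t)).
  transitivity (\int[P]_u (k * cos (t / e * x) * cos (t / e * u)
      + k * sin (t / e * x) * sin (t / e * u)))%R.
    apply: eq_Rintegral => u _; rewrite /f /= mul0r addr0 !mul1r.
    have -> : (u - x) / e * t = t / e * u - t / e * x by field; rewrite gt_eqF.
    by rewrite cosB /k mul1r; ring.
  by rewrite integral_trig_comb /k; ring.
have mcauchy : measurable_fun setT cauchy.
  apply: measurable_comp (@measurable_inv R) _; apply: measurable_funD => //.
  by apply: measurable_funX; apply: measurable_funM => //; exact: measurable_funB.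
have c1 u : `|cauchy u| <= 1.
  rewrite ger0_norm ?invr_ge0 ?(ltW (p0 u))// invf_le1//.
  by rewrite lerDl sqr_ge0.
have ic := integrable_bounded P mcauchy c1.
have exch := @Rintegral_exchange _ _ _ _ R mu P f _ _ mf ie i1 fle.
have io := @integrable_dominated_slice _ _ _ _ R mu P f _ _ mf ie i1 fle.
apply: (@le_trans _ _ (\int[P]_u (2 * cauchy u))%R).
  apply: fine_probability_le_integral => //.
    exact: (integrableZl measurableT 2 ic).
  move=> u; rewrite indic_itvE in_itv/=.
  have [/andP[xu ue]|_] := boolP (x <= u <= x + e); last first.
    by rewrite mulr_ge0// invr_ge0 ltW.
  rewrite ler_pdivlMr// mul1r.
  have : ((u - x) / e) ^+ 2 <= 1.
    rewrite expr_le1// ?divr_ge0//; [|lra|lra].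
    by rewrite ler_pdivrMr//; lra.
  by lra.
rewrite RintegralZl//.
have -> : (\int[P]_u cauchy u)%R = (\int[mu]_t \int[P]_u f (t, u))%R.
  by rewrite exch; apply: eq_Rintegral => u _; rewrite inner.
have eZ : 0 < e * Zc by rewrite mulr_gt0.
have is_ := integrable_indic_segment eZ.
have [_] := @integral_segment R (fun=> 1) (fun x => x) _ _ eZ
    (fun x _ => isd_continuous (isd_cst 1 x)) (fun x _ => isd_id x).
have E1 (z : R) : \1_`[0, e * Zc] z * 1 = \1_`[0, e * Zc] z :> R by rewrite mulr1.
rewrite (eq_lebesgue E1) subr0 => es.
have j1 := integrableZl measurableT 2 is_.
have j2 := integrableZl measurableT (2 * theta) ie.
have J : (\int[mu]_t (2 * \1_`[0, e * Zc] t + 2 * theta * (\1_`]0, +oo[ t * expR (-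
  (1 * t)))))%R
   = 2 * (e * Zc) + 2 * theta.
  by rewrite RintegralD// !RintegralZl// es ee invr1 mulr1.
have -> : 4 * (e * Zc) + 4 * theta = 2 * (2 * (e * Zc) + 2 * theta) by ring.
rewrite ler_wpM2l// -J; apply: le_Rintegral => //.
  exact: (integrableD measurableT j1 j2).
move=> t _; rewrite outer !indic_itvE !in_itv/= andbT.
have [t0|t0] := boolP (0 < t); last first.
  by rewrite !mul0r mulr0 addr0 mulr_ge0// ler0n.
rewrite !mul1r (ltW t0)/=.
set c := cos_transform P _; set s := sin_transform P _.
have bnd m : `|c| <= m -> `|s| <= m -> cos (t / e * x) * c + sin
  (t / e * x) * s <= 2 * m.
  move=> cm sm; apply: (le_trans (ler_norm _)); apply: (le_trans (ler_normD _ _)).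
  rewrite mulr_natl mulr2n !normrM lerD//.
    by rewrite (le_trans _ cm)// ler_piMl// cos_max.
  by rewrite (le_trans _ sm)// ler_piMl// sin_max.
have [tZ|tZ] := leP t (e * Zc).
  rewrite mulr1; apply: ler_wpDr; first by rewrite !mulr_ge0 ?expR_ge0.
  have b1 := bnd 1 (cos_transform_le1 _ _) (sin_transform_le1 _ _).
  have e1 : expR (- t) <= 1 by rewrite -[leRHS]expR0 ler_expR oppr_le0 ltW.
  have ep := expR_ge0 (- t).
  by nra.
rewrite mulr0 add0r mulrC ler_wpM2r ?expR_ge0//.
have Zt : Zc <= t / e by rewrite ler_pdivlMr// mulrC ltW.
by have [cd sd] := Pdec _ Zt; exact: bnd.
Qed.

Lemma cdf_shift_le (R : realType) (P : probability R R) (x e : R) :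
  fine (P `]-oo, x + e]%classic) <= fine (P `]-oo, x]%classic) + fine
    (P `[x, x + e]%classic).
Proof.
rewrite -fineD ?fin_num_measure//; apply: fine_le; rewrite ?fin_numD ?fin_num_measure//.
apply: (@le_trans _ _ (P (`]-oo, x] `|` `[x, x + e]))).
  apply: le_measure; rewrite ?inE//; first exact: measurableU.
  move=> y /=; rewrite !in_itv/= => ye.
  by have [yx|/ltW xy] := leP y x; [left|right; rewrite xy].
exact: measureU2.
Qed.

(** The regularity of one of the two laws suffices: it absorbs the shift of
    the smoothing inequality in both directions. *)
Lemma cdf_dist_le (R : realType) (P Q : probability R R) (e M eta Zc theta : R) :
  0 < e -> 0 < M -> 0 <= eta -> 0 < Zc -> 0 <= theta ->
  (forall z, 0 < z <= M ->
     `|cos_transform Q z - cos_transform P z| + `|sin_transform Q z - sin_transform P z|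
       <= eta * (z ^+ 2 / (1 + z ^+ 2))) ->
  (forall z, Zc <= z -> `|cos_transform P z| <= theta /\ `|sin_transform P z| <=
    theta) ->
  forall x, `|fine (Q `]-oo, x]%classic) - fine (P `]-oo, x]%classic)| <=
    (tent_const R)^-1 * (eta / 2 * ln (1 + M ^+ 2) + 8 / (e * M)) +
    (4 * (e * Zc) + 4 * theta).
Proof.
move=> e0 M0 eta0 Z0 th0 QP Pdec x.
have PQ z : 0 < z <= M ->
   `|cos_transform P z - cos_transform Q z| + `|sin_transform P z - sin_transform Q z|
       <= eta * (z ^+ 2 / (1 + z ^+ 2)).
  by move=> zM; rewrite distrC [X in _ + X]distrC; exact: QP.
have h1 := cdf_smoothing x e0 M0 eta0 QP.
have h2 := cdf_smoothing (x - e) e0 M0 eta0 PQ; rewrite subrK in h2.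
have h3 := cdf_shift_le P x e.
have h4 := cdf_shift_le P (x - e) e; rewrite subrK in h4.
have h5 := concentration_bound x e0 Z0 th0 Pdec.
have h6 := concentration_bound (x - e) e0 Z0 th0 Pdec; rewrite subrK in h6.
by rewrite ler_norml; lra.
Qed.

(** * Transforms of sums of independent variables *)

Section Independence.
Context d (T : measurableType d) (R : realType) (P : probability T R).

Lemma layer_cake (G Y : T -> R) (M : R) :
  measurable_fun setT G -> measurable_fun setT Y ->
  (forall w, `|G w| <= M) -> (forall w, `|Y w| <= 1) ->
  mu.-integrable setT (EFin \o (fun t : R =>
    \1_`[(-1), 1] t * (\int[P]_w (G w * \1_`]0, +oo[ (Y w - t)))%R)) /\
  (\int[mu]_t (\1_`[(-1), 1] t * \int[P]_w (G w * \1_`]0, +oo[ (Y w - t))) =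
   \int[P]_w (G w * (Y w + 1)))%R.
Proof.
move=> mG mY GM Y1.
pose f (p : R * T) : R := G p.2 * (\1_`[(-1), 1] p.1 * \1_`]0, +oo[ (Y p.2 - p.1)).
have N11 : -1 < 1 :> R by lra.
have i1 : P.-integrable setT (EFin \o
  (fun=> M)) by exact: finite_measure_integrable_cst.
have mY' : measurable_fun setT (fun p : R * T => Y p.2 - p.1).
  by apply: measurable_funB => //; exact: measurableT_comp.
have mf : measurable_fun setT f.
  apply: measurable_funM; first exact: measurableT_comp.
  by apply: measurable_funM;
    [exact: measurable_comp (measurable_indic_itv _) measurable_fst|exact:
      measurable_comp (measurable_indic_itv _) mY'].
have fle t w : `|f (t, w)| <= \1_`[(-1), 1] t * M.
  rewrite /f /= normrM [X in _ * X]ger0_norm; last by rewrite !indic_itvE mulr_ge0.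
  rewrite [leRHS]mulrC; apply: ler_pM => //; rewrite !indic_itvE ?mulr_ge0//.
  by rewrite ler_piMr// lern1 leq_b1.
have := @integrable_dominated_slice _ _ _ _ R mu P f _ _ mf
  (integrable_indic_segment N11) i1 fle.
have := @Rintegral_exchange _ _ _ _ R mu P f _ _ mf
  (integrable_indic_segment N11) i1 fle.
have inner w : (\int[mu]_t f (t, w))%R = G w * (Y w + 1).
  have Yw := Y1 w; move: Yw; rewrite ler_norml => /andP[Yw0 Yw1].
  have E t : f (t, w) = G w * \1_`[(-1), Y w[ t.
    rewrite /f /= !indic_itvE !in_itv/= andbT subr_gt0 -natrM mulnb;
      congr (_ * (nat_of_bool _)%:R).
    by apply/idP/idP; lra.
  have mI : measurable (`[(-1), Y w[%classic : set R) by exact: measurable_itv.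
  have vI : mu `[(-1), Y w[%classic = (Y w + 1)%:E.
    rewrite lebesgue_measure_itv/= lte_fin; case: ltP => h.
      by rewrite -EFinD opprK.
    by congr EFin; lra.
  have iI : mu.-integrable setT (EFin \o (\1_`[(-1), Y w[ : R -> R)).
    exact: integrable_indic_itv.
  rewrite (eq_lebesgue E) RintegralZl//; congr (_ * _).
  rewrite /Rintegral integral_indic// -[RHS]/(fine (Y w + 1)%:E) -vI.
  by congr (fine (mu _)); exact: setIT.
have -> : (\int[P]_w \int[mu]_t f (t, w))%R = (\int[P]_w (G w * (Y w + 1)))%R.
  by apply: eq_Rintegral => w _; exact: inner.
have outer t : (\int[P]_w f (t, w))%R =
    \1_`[(-1), 1] t * (\int[P]_w (G w * \1_`]0, +oo[ (Y w - t)))%R.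
  rewrite -RintegralZl//; last first.
    apply: (@integrable_bounded _ _ _ _ _ M) => [|w].
      by apply: measurable_funM => //;
        apply: measurable_comp (measurable_indic_itv _) _; exact: measurable_funB.
    by rewrite normrM (le_trans _ (GM w))// ler_piMr// indic_itvE ger0_norm// lern1
      leq_b1.
  by apply: eq_Rintegral => w _; rewrite /f /=; ring.
by rewrite (eq_lebesgue outer) => <- ii; split=> //; apply: eq_integrable_lebesgue ii.
Qed.

(** It suffices to test independence on the events [Y > t], by the layer-cake
    formula. *)
Lemma integral_mul_of_events (G Y : T -> R) (M g : R) :
  measurable_fun setT G -> measurable_fun setT Y ->
  (forall w, `|G w| <= M) -> (forall w, `|Y w| <= 1) ->
  (\int[P]_w G w)%R = g ->
  (forall t, (\int[P]_w (G w * \1_`]0, +oo[ (Y w - t)))%R =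
     g * (\int[P]_w (\1_`]0, +oo[ (Y w - t)))%R) ->
  (\int[P]_w (G w * Y w))%R = g * (\int[P]_w Y w)%R.
Proof.
move=> mG mY GM Y1 Gg H.
have m1 : measurable_fun setT (fun _ : T => 1 : R) by [].
have [_ LG] := layer_cake mG mY GM Y1.
have [i2 L1] := layer_cake m1 mY (fun=> lexx _) Y1.
have iY := integrable_bounded P mY Y1.
have iG := integrable_bounded P mG GM.
have i1 : P.-integrable setT (EFin \o
  (fun=> 1 : R)) by exact: finite_measure_integrable_cst.
have iGY : P.-integrable setT (EFin \o (fun w => G w * Y w)).
  apply: (@integrable_bounded _ _ _ _ _ M) => [|w]; first exact: measurable_funM.
  by rewrite normrM (le_trans _ (GM w))// ler_piMr.
have EG : (\int[P]_w (G w * (Y w + 1)))%R = (\int[P]_w (G w * Y w))%R + g.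
  transitivity (\int[P]_w (G w * Y w + G w))%R.
    by apply: eq_Rintegral => w _; rewrite mulrDr mulr1.
  by rewrite RintegralD// Gg.
have E1 : (\int[P]_w (1 * (Y w + 1)))%R = (\int[P]_w Y w)%R + 1.
  transitivity (\int[P]_w (Y w + 1))%R.
    by apply: eq_Rintegral => w _; rewrite mul1r.
  by rewrite RintegralD// Rintegral_cst// /= probability_setT/= mulr1.
suff : (\int[P]_w (G w * Y w))%R + g = g * ((\int[P]_w Y w)%R + 1).
  by rewrite mulrDr mulr1 => /addIr.
rewrite -EG -E1 -LG -L1.
rewrite -RintegralZl//; apply: eq_lebesgue => t.
rewrite H mulrCA; congr (_ * (_ * _)).
by apply: eq_Rintegral => w _; rewrite mul1r.
Qed.

Variables (I : finType) (X : I -> {RV P >-> R}).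
Hypothesis indepX : mutually_independent X.

Lemma independent_indicators (r : seq I) (B : I -> set R) : uniq r ->
  (forall i, measurable (B i)) ->
  (\int[P]_w (\prod_(i <- r) \1_(B i) (X i w)))%R =
  \prod_(i <- r) (\int[P]_w \1_(B i) (X i w))%R.
Proof.
move=> ur mB.
have mXB i : measurable (X i @^-1` B i).
  by rewrite -[_ @^-1` _]setTI; exact: measurable_funPT.
have E1 i : (\int[P]_w \1_(B i) (X i w))%R = fine (P (X i @^-1` B i)).
  transitivity (\int[P]_w \1_(X i @^-1` B i) w)%R.
    by apply: eq_Rintegral => w _; rewrite !indicE; congr (nat_of_bool _)%:R;
      apply/idP/idP; rewrite !inE.
  by rewrite /Rintegral integral_indic// setIT.
pose J := [set i in r]%SET.
have mF : measurable (\bigcap_(i in [set` J]) X i @^-1` B i).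
  by apply: fin_bigcap_measurable => //; exact: finite_finset.
transitivity (fine (P (\bigcap_(i in [set` J]) X i @^-1` B i))).
  transitivity (\int[P]_w \1_(\bigcap_(i in [set` J]) X i @^-1` B i) w)%R; last first.
    by rewrite /Rintegral integral_indic// setIT.
  apply: eq_Rintegral => w _; rewrite indicE.
  have [wJ|wJ] := boolP (w \in _).
    rewrite big_seq big1// => i ir; rewrite indicE mem_set//.
    by move: wJ; rewrite inE => /(_ i); apply; rewrite /= inE.
  have [i ir Bi] : exists2 i, i \in r & w \notin X i @^-1` B i.
    apply: contrapT => H; move/negP: wJ; apply; rewrite inE => i /=; rewrite inE => ir.
    by apply: contrapT => Bi; apply: H; exists i => //; apply/negP; rewrite inE.
  rewrite (big_rem i)//= indicE memNset ?mul0r//.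
  by move=> h; move/negP: Bi; apply; rewrite inE.
rewrite indepX//.
have -> : (\prod_(i in J) P (X i @^-1` B i))%E = (\prod_(i in J) (fine (P
  (X i @^-1` B i)))%:E)%E.
  by apply: eq_bigr => i _; rewrite fineK// fin_num_measure.
rewrite prodEFin /=.
rewrite (eq_bigl (fun i => i \in r)); last by move=> i; rewrite inE.
by rewrite big_uniq//; apply: eq_bigr => i _.
Qed.

Variables (t A B : I -> R).
Hypotheses
  (cosX : forall i, (\int[P]_w cos (t i * X i w))%R = expR (A i) * cos (B i))
  (sinX : forall i, (\int[P]_w sin (t i * X i w))%R = expR (A i) * sin (B i)).

Let S (r : seq I) w := \sum_(i <- r) t i * X i w.

Let measurable_S r : measurable_fun setT (S r).
Proof. by apply: measurable_sum => i; exact: measurable_funM. Qed.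

Let measurable_tests (r : seq I) (E : I -> set R) : (forall i, measurable (E i)) ->
  measurable_fun setT (fun w => \prod_(i <- r) \1_(E i) (X i w) : R).
Proof.
move=> mE; apply: measurable_prod => i _.
by apply: measurable_comp => //; exact: measurable_indic.
Qed.

Let tests_le1 (r : seq I) (E : I -> set R) w :
  0 <= (\prod_(i <- r) \1_(E i) (X i w) : R) <= 1.
Proof.
elim: r => [|i r /andP[h1 h2]]; first by rewrite big_nil ler01 lexx.
by rewrite big_cons indicE; case: (_ \in _); rewrite ?mul1r ?h1 ?h2// mul0r lexx ler01.
Qed.

(** Transferring the variables one by one from the indicator factors to the
    trigonometric sum, the remaining indicators serving as the events on which
    the next variable is tested. *)
Lemma independent_trig_sum (r s : seq I) (E : I -> set R) (x y : R) :
  uniq (r ++ s) -> (forall i, measurable (E i)) ->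
  (\int[P]_w ((x * cos (S r w) + y * sin (S r w)) *
      \prod_(i <- s) \1_(E i) (X i w)))%R =
  expR (\sum_(i <- r) A i) * (x * cos (\sum_(i <- r) B i) + y * sin
    (\sum_(i <- r) B i)) *
    \prod_(i <- s) (\int[P]_w \1_(E i) (X i w))%R.
Proof.
elim: r s E x y => [|k r IH] s E x y /=.
  move=> us mE; rewrite !big_nil expR0 cos0 sin0 mulr0 addr0 mulr1 mul1r.
  rewrite -independent_indicators// -RintegralZl//; last first.
    apply: (@integrable_bounded _ _ _ _ _ 1) => [|w]; first exact: measurable_tests.
    by have /andP[h1 h2] := tests_le1 s E w; rewrite ger0_norm.
  by apply: eq_Rintegral => w _; rewrite /S !big_nil cos0 sin0 mulr0 addr0 mulr1.
rewrite mem_cat negb_or -andbA => /and3P[kr ks urs] mE.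
pose pi_s w := \prod_(i <- s) \1_(E i) (X i w) : R.
pose beta := \prod_(i <- s) (\int[P]_w \1_(E i) (X i w))%R.
pose G x y w := (x * cos (S r w) + y * sin (S r w)) * pi_s w.
pose g x y := expR (\sum_(i <- r) A i) *
  (x * cos (\sum_(i <- r) B i) + y * sin (\sum_(i <- r) B i)) * beta.
have mpi : measurable_fun setT pi_s by exact: measurable_tests.
have mG x' y' : measurable_fun setT (G x' y').
  apply: measurable_funM => //; apply: measurable_funD; apply: measurable_funM => //.
    exact: measurable_comp (@measurable_cos R) (measurable_S r).
  exact: measurable_comp (@measurable_sin R) (measurable_S r).
have Gle x' y' w : `|G x' y' w| <= `|x'| + `|y'|.
  have /andP[p0 p1] := tests_le1 s E w.
  rewrite /G normrM (ger0_norm p0) -[leRHS]mulr1 ler_pM//.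
  by rewrite (le_trans (ler_normD _ _))// !normrM lerD// ler_piMr// ?cos_max ?sin_max.
have Gg x' y' : (\int[P]_w G x' y' w)%R = g x' y' by apply: IH.
have test (phi : R -> R) x' y' : measurable_fun setT phi -> (forall u, `|phi u| <= 1) ->
    (\int[P]_w (G x' y' w * phi (t k * X k w)))%R =
    g x' y' * (\int[P]_w phi (t k * X k w))%R.
  move=> mphi phi1.
  have mY : measurable_fun setT (fun w => phi (t k * X k w)).
    by apply: measurable_comp => //; exact: measurable_funM.
  apply: (integral_mul_of_events (mG x' y') mY (Gle x' y')) => // c.
  pose D : set R := [set u | 0 < phi (t k * u) - c].
  have mD : measurable D.
    have mphi' : measurable_fun setT (fun u => phi (t k * u) - c).
      by apply: measurable_funB => //; apply: measurable_comp => //;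
        exact: measurable_funM.
    have -> : D = (fun u => phi (t k * u) - c) @^-1` `]0, +oo[.
      by apply/seteqP; split => u; rewrite /D /= in_itv/= andbT.
    by rewrite -[_ @^-1` _]setTI; apply: mphi'.
  pose E' i := if i == k then D else E i.
  have mE' i : measurable (E' i) by rewrite /E'; case: ifP.
  have DE w : \1_`]0, +oo[ (phi (t k * X k w) - c) = \1_D (X k w) :> R.
    rewrite indic_itvE in_itv/= andbT indicE; congr (nat_of_bool _)%:R.
    by apply/idP/idP; rewrite inE.
  have urks : uniq (r ++ k :: s).
    by rewrite -cat_rcons (perm_uniq (perm_cat (permEl (perm_rcons _ _))
      (perm_refl _))) /= mem_cat negb_or kr ks.
  have sE' (F : I -> set R -> R) : \prod_(i <- s) F i (E' i) = \prod_(i <- s) F i (E i).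
    rewrite big_seq [RHS]big_seq; apply: eq_bigr => i is_.
    by rewrite /E'; case: eqP => // ik; move: is_; rewrite ik (negbTE ks).
  have := IH (k :: s) E' x' y' urks mE'.
  have E'k : E' k = D by rewrite /E' eqxx.
  rewrite [X in _ = _ * X]big_cons E'k (sE' (fun i F => (\int[P]_w \1_F
    (X i w))%R)) -/beta.
  move=> IHk.
  transitivity (\int[P]_w ((x' * cos (S r w) + y' * sin (S r w)) *
      \prod_(i <- k :: s) \1_(E' i) (X i w)))%R.
    apply: eq_Rintegral => w _.
    rewrite big_cons E'k (sE' (fun i F => \1_F (X i w))) -/(pi_s w) DE /G; ring.
  rewrite IHk /g.
  have -> : (\int[P]_w \1_`]0, +oo[ (phi (t k * X k w) - c))%R = (\int[P]_w \1_D
    (X k w))%R.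
    by apply: eq_Rintegral => w _; exact: DE.
  by ring.
have tc := test _ x y (@measurable_cos R) (@cos_max R).
have ts := test _ y (- x) (@measurable_sin R) (@sin_max R).
have mc : measurable_fun setT (fun w => cos (t k * X k w)).
  by apply: measurable_comp (@measurable_cos R) _; exact: measurable_funM.
have ms : measurable_fun setT (fun w => sin (t k * X k w)).
  by apply: measurable_comp (@measurable_sin R) _; exact: measurable_funM.
transitivity (\int[P]_w (G x y w * cos (t k * X k w) + G y (- x) w * sin
  (t k * X k w)))%R.
  apply: eq_Rintegral => w _; rewrite /S big_cons -/(S r w) cosD sinD /G /pi_s; ring.
rewrite RintegralD//.
- rewrite tc ts cosX sinX /g !big_cons expRD cosD sinD /beta; ring.
- apply: (@integrable_bounded _ _ _ _ _ (`|x| + `|y|)) => [|w];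
  first exact: measurable_funM.
  by rewrite normrM (le_trans _ (Gle x y w))// ler_piMr// cos_max.
- apply: (@integrable_bounded _ _ _ _ _ (`|y| + `|- x|)) => [|w];
  first exact: measurable_funM.
  by rewrite normrM (le_trans _ (Gle y (- x) w))// ler_piMr// sin_max.
Qed.

End Independence.

(** * The characteristic exponent *)

Lemma charfunE (R : realType) (P : probability R R) (z : R) :
  charfun P z = (cos_transform P z +i* sin_transform P z)%C.
Proof.
rewrite /charfun /cintegral /cos_transform /sin_transform.
by congr (_ +i* _)%C; apply: eq_Rintegral => u _; rewrite /cexp /=;
  rewrite !(mul0r, mulr0, mul1r, subr0, addr0, add0r, oppr0) expR0 mul1r.
Qed.

(** The real part of the principal logarithm of [1 - i y]. *)
Definition half_log (R : realType) (y : R) : R := ln (1 + y ^+ 2) / 2.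

Lemma cexpE (R : realType) (x y : R) :
  cexp (x +i* y)%C = ((expR x * cos y) +i* (expR x * sin y))%C.
Proof. by rewrite /cexp /=; congr (_ +i* _)%C; rewrite ?(mul0r, subr0, addr0). Qed.

(** [1 - i y] lies in the right half-plane, where the arccosine that defines the
    argument is the arctangent up to sign. *)
Lemma clog_onem_i (R : realType) (y : R) :
  clog (1 - 'i * y%:C)%C = (half_log y +i* (- atan y))%C.
Proof.
have E : (1 - 'i * y%:C)%C = (1 +i* (- y))%C :> R[i].
  by apply/eqP; rewrite eq_complex /=; apply/andP; split; apply/eqP; ring.
have p0 : 0 < 1 + y ^+ 2 by rewrite ltr_pwDl// sqr_ge0.
have nE : Normc.normc (1 +i* (- y) : R[i])%C = Num.sqrt (1 + y ^+ 2).
  by rewrite /Normc.normc /= expr1n sqrrN.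
rewrite E /clog nE /half_log; congr (_ +i* _)%C.
  by rewrite -powR12_sqrt ?ltW// ln_powR mulrC.
rewrite /carg nE /= div1r -cos_atan oppr_ge0.
have := atan_gtNpi2 y; have := atan_ltpi2 y; have := @pi_gt0 R => h1 h2 h3.
have [y0|y0] := leP y 0.
  have : atan y <= 0 by rewrite -atan0 le_atan.
  by move=> h; rewrite -[in LHS](opprK (atan y)) cosN cosK// in_itv/=; lra.
have : 0 <= atan y by rewrite -atan0 le_atan// ltW.
by move=> h; rewrite cosK// in_itv/=; lra.
Qed.

Lemma gamma_transform (R : realType) (P : probability R R) (a s z : R) :
  is_gamma P a s ->
  cos_transform P z = expR (- (s * half_log (z / a))) * cos (s * atan (z / a)) /\
  sin_transform P z = expR (- (s * half_log (z / a))) * sin (s * atan (z / a)).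
Proof.
move=> /(_ z); rewrite charfunE /cpow clog_onem_i.
set w := (X in cexp X).
have -> : w = (- (s * half_log (z / a)) +i* (s * atan (z / a)))%C.
  by rewrite /w; apply/eqP; rewrite eq_complex /=; apply/andP; split; apply/eqP; ring.
by rewrite cexpE => -[-> ->].
Qed.

Lemma Rintegral_sum (R : realType) (I : Type) (s : seq I) (f : I -> R -> R) :
  (forall i, mu.-integrable setT (EFin \o f i)) ->
  mu.-integrable setT (EFin \o (fun u => \sum_(i <- s) f i u)) /\
  (\int[mu]_u (\sum_(i <- s) f i u) = \sum_(i <- s) \int[mu]_u f i u)%R.
Proof.
move=> fi; elim: s => [|i s [IHi IHe]].
  have E (u : R) : \sum_(i <- [::]) f i u = 0 by rewrite big_nil.
  rewrite big_nil (eq_lebesgue E) Rintegral_cst// mul0r; split=> //.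
  apply: (eq_integrable_lebesgue (f := fun=> 0)) (integrable0 _ _).
  by move=> u; rewrite E.
have E (u : R) : \sum_(i <- i :: s) f i u = f i u + \sum_(i <- s) f i u by rewrite
  big_cons.
rewrite big_cons (eq_lebesgue E) RintegralD// IHe; split=> //.
apply: (eq_integrable_lebesgue (f := fun u => f i u + \sum_(i <- s) f i u)).
  by move=> u; rewrite E.
exact: (integrableD measurableT (fi i) IHi).
Qed.

Section LevyExponent.
Context {R : realType} {n : nat}.
Variables alpha p beta q w1 w2 : 'I_n -> R.

(** The exponent of the characteristic function of [T] is
    [exponent_re + i exponent_im]. *)
Definition exponent_re (z : R) : R :=
  - \sum_(j < n) (p j * half_log (z / (alpha j / w1 j)) +
                  q j * half_log (z / (beta j / w2 j))).

Definition exponent_im (z : R) : R :=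
  \sum_(j < n) (p j * atan (z / (alpha j / w1 j)) - q j * atan (z / (beta j / w2 j))).

Hypotheses (halpha : forall j, 0 < alpha j) (hbeta : forall j, 0 < beta j)
  (hw1 : forall j, 0 < w1 j) (hw2 : forall j, 0 < w2 j).

(** Each half-line is a Frullani integral; the negative one is the mirror
    image of a positive one, which flips the sign of the sine part only. *)
Lemma integral_levy_density (z x y : R) :
  (\int[mu]_u (levy_density alpha p beta q w1 w2 u *
      (x * sin (z * u) + y * (1 - cos (z * u)))))%R =
  x * exponent_im z - y * exponent_re z.
Proof.
pose g (b x u : R) : R := \1_`]0, +oo[ u *
     (u^-1 * expR (- (b * u)) * (x * sin (z * u) + y * (1 - cos (z * u)))).
have b1 j : 0 < alpha j / w1 j by rewrite divr_gt0.
have b2 j : 0 < beta j / w2 j by rewrite divr_gt0.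
pose f j (u : R) : R := p j * g (alpha j / w1 j) x u + q j * g (beta j / w2 j) (- x)
  (-1 * u).
have E (u : R) : levy_density alpha p beta q w1 w2 u *
      (x * sin (z * u) + y * (1 - cos (z * u))) = \sum_(j < n) f j u.
  rewrite /levy_density mulr_sumr mulr_suml; apply: eq_bigr => j _.
  rewrite /f /g !indic_itvE !in_itv/= !andbT mulN1r oppr_gt0 invrN !mulrN sinN cosN.
  have -> : alpha j / w1 j * u = alpha j * u / w1 j by ring.
  have [u0|u0|->] := ltgtP u 0.
  - rewrite ltr0_norm//.
    have -> : - (beta j / w2 j * u) = beta j * - u / w2 j by ring.
    by ring.
  - by rewrite /=; ring.
  - by rewrite /= !(mulr0, mul0r, invr0, subr0, addr0).
have N1 : -1 != 0 :> R by rewrite oppr_eq0 oner_eq0.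
have fi j : mu.-integrable setT (EFin \o f j) /\ (\int[mu]_u f j u)%R =
   x * (p j * atan (z / (alpha j / w1 j)) - q j * atan (z / (beta j / w2 j)))
   + y * (p j * half_log (z / (alpha j / w1 j)) + q j * half_log (z / (beta j / w2 j))).
  have [i1 e1] := frullani_trig z x y (b1 j).
  have [i2 e2] := frullani_trig z (- x) y (b2 j).
  have := Rintegral_scale N1 i2; rewrite normrN normr1 mul1r => e3.
  have i2' := integrable_scale N1 i2.
  have i3 := integrableZl measurableT (p j) i1.
  have i4 := integrableZl measurableT (q j) i2'.
  split; first exact: (integrableD measurableT i3 i4).
  by rewrite RintegralD// !RintegralZl// e1 -e3 e2 /half_log; ring.
rewrite (eq_lebesgue E).
have [_ ->] := Rintegral_sum (index_enum 'I_n) (fun j => (fi j).1).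
rewrite /exponent_im /exponent_re mulrN opprK !mulr_sumr -big_split/=.
by apply: eq_bigr => j _; rewrite (fi j).2.
Qed.

Lemma levy_integralE (z : R) :
  levy_integral alpha p beta q w1 w2 (fun u => cexp ('i%C * (z * u)%:C%C) - 1) =
  (exponent_re z +i* exponent_im z)%C.
Proof.
have c u : cexp ('i%C * (z * u)%:C%C) = (cos (z * u) +i* sin (z * u))%C.
  rewrite /cexp /=; apply/eqP; rewrite eq_complex /=.
  by rewrite !(mul0r, mulr0, mul1r, subr0, addr0, add0r, oppr0) expR0 !mul1r !eqxx.
rewrite /levy_integral /cintegral; congr (_ +i* _)%C.
  have := integral_levy_density z 0 (-1); rewrite mul0r mulN1r opprK add0r => <-.
  by apply: eq_lebesgue => u; rewrite c /=; ring.
have := integral_levy_density z 1 0; rewrite mul0r mul1r subr0 => <-.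
by apply: eq_lebesgue => u; rewrite c /=; ring.
Qed.

End LevyExponent.

(** * Comparison of an exponential with its compound Poisson approximation *)

Lemma expR_lipschitz (R : realType) (x y : R) : x <= 0 -> y <= 0 ->
  `|expR x - expR y| <= `|x - y|.
Proof.
wlog yx : x y / y <= x.
  move=> H x0 y0; have [/H->//|/ltW yx] := leP y x.
  by rewrite distrC [leRHS]distrC H.
move=> x0 y0; rewrite ger0_norm ?subr_ge0 ?ler_expR// ger0_norm ?subr_ge0//.
have h1 := expR_ge1Dx (y - x).
have -> : expR y = expR x * expR (y - x) by rewrite -expRD addrC subrK.
have h2 : expR x <= 1 by rewrite -[leRHS]expR0 ler_expR.
have h3 := expR_ge0 x.
rewrite -{1}(mulr1 (expR x)) -mulrBr.
have [h4|h4] := leP (1 - expR (y - x)) 0; first by nra.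
by nra.
Qed.

Lemma expR_taylor2 (R : realType) (a : R) : a <= 0 ->
  0 <= expR a - 1 - a <= a ^+ 2.
Proof.
move=> a0; have h1 := expR_ge1Dx a; apply/andP; split; first lra.
have [|c] := @MVT_segment R expR expR a 0 a0 (fun t _ => is_derive_expR t).
  by apply: continuous_subspaceT; exact: continuous_expR.
rewrite in_itv/= expR0 sub0r => /andP[ac c0] E.
have h2 := expR_ge1Dx c.
have -> : expR a = 1 - expR c * - a by rewrite -E; ring.
by nra.
Qed.

Lemma sin_taylor2 (R : realType) (b : R) : `|sin b - b| <= b ^+ 2.
Proof.
wlog b0 : b / 0 <= b.
  move=> H; have [/H//|/ltW b0] := leP 0 b.
  by have := H (- b); rewrite sinN -opprD normrN sqrrN; apply; rewrite oppr_ge0.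
have [|c] := @MVT_segment R sin cos 0 b b0 (fun y _ => is_derive_sin y).
  by apply: continuous_subspaceT; exact: continuous_sin.
rewrite in_itv/= sin0 !subr0 => /andP[c0 cb] ->.
have := cos_lipschitz c 0; rewrite cos0 subr0 (ger0_norm c0) => h.
rewrite -{2}(mul1r b) -mulrBl normrM (ger0_norm b0) expr2 ler_wpM2r//.
exact: le_trans cb.
Qed.

Lemma sqr_norm_le (R : realType) (a b : R) : `|a| * `|b| <= a ^+ 2 + b ^+ 2.
Proof.
rewrite -[a ^+ 2]real_normK ?num_real// -[b ^+ 2]real_normK ?num_real//.
have h1 := normr_ge0 a; have h2 := normr_ge0 b.
have := sqr_ge0 (`|a| - `|b|); nra.
Qed.

(** With [cexp_taylor_im], the two parts of [exp w - 1 - w = O(|w|^2)] for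
    [w = a + i b] in the left half-plane. *)
Lemma cexp_taylor_re (R : realType) (a b : R) : a <= 0 ->
  `|expR a * cos b - 1 - a| <= a ^+ 2 + b ^+ 2.
Proof.
move=> a0.
have -> : expR a * cos b - 1 - a = (expR a - 1 - a) - expR a * (1 - cos b) by ring.
have /andP[h1 h2] := expR_taylor2 a0.
have /andP[h3 h4] := onem_cos_le b.
have h5 := expR_ge0 a.
have h6 : expR a <= 1 by rewrite -[leRHS]expR0 ler_expR.
have h7 : 0 <= expR a * (1 - cos b) <= b ^+ 2 by nra.
by rewrite ler_norml; have := sqr_ge0 a; have := sqr_ge0 b; lra.
Qed.

Lemma cexp_taylor_im (R : realType) (a b : R) : a <= 0 ->
  `|expR a * sin b - b| <= 2 * (a ^+ 2 + b ^+ 2).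
Proof.
move=> a0.
have -> : expR a * sin b - b = (expR a - 1) * sin b + (sin b - b) by ring.
apply: (le_trans (ler_normD _ _)).
have h1 : `|expR a - 1| <= `|a|.
  by have := expR_lipschitz a0 (lexx 0); rewrite expR0 subr0.
have h2 := normr_sin_le b; have h3 := sin_taylor2 b; have h4 := sqr_norm_le a b.
have h5 : `|(expR a - 1) * sin b| <= `|a| * `|b| by rewrite normrM ler_pM.
by have := sqr_ge0 a; lra.
Qed.

(** For [w = a + i b], the compound Poisson exponent [m (exp (w / m) - 1)]
    differs from [w] by [O(|w|^2 / m)]; like [w] it lies in the left half-plane,
    where the exponential is a contraction. *)
Lemma compound_poisson_approx (R : realType) (m a b a' b' : R) : 0 < m -> a <= 0 ->
  a' = m * (expR (a / m) * cos (b / m) - 1) ->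
  b' = m * (expR (a / m) * sin (b / m)) ->
  `|expR a' * cos b' - expR a * cos b| + `|expR a' * sin b' - expR a * sin b| <=
    6 * (a ^+ 2 + b ^+ 2) / m.
Proof.
move=> m0 a0 a'E b'E.
have am0 : a / m <= 0 by rewrite pmulr_lle0// invr_gt0.
have mn : m != 0 by rewrite gt_eqF.
have da : `|a' - a| <= (a ^+ 2 + b ^+ 2) / m.
  have -> : a' - a = m * (expR (a / m) * cos (b / m) - 1 - a / m) by rewrite a'E; field.
  have -> : (a ^+ 2 + b ^+ 2) / m = m * ((a / m) ^+ 2 + (b / m) ^+ 2) by field.
  by rewrite normrM gtr0_norm// ler_pM2l// cexp_taylor_re.
have db : `|b' - b| <= 2 * (a ^+ 2 + b ^+ 2) / m.
  have -> : b' - b = m * (expR (a / m) * sin (b / m) - b / m) by rewrite b'E; field.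
  have -> : 2 * (a ^+ 2 + b ^+ 2) / m = m * (2 * ((a / m) ^+ 2 +
    (b / m) ^+ 2)) by field.
  by rewrite normrM gtr0_norm// ler_pM2l// cexp_taylor_im.
have a'0 : a' <= 0.
  rewrite a'E pmulr_rle0// subr_le0.
  have e1 : expR (a / m) <= 1 by rewrite -[leRHS]expR0 ler_expR.
  have e0 := expR_ge0 (a / m); have c1 := cos_le1 (b / m).
  by nra.
have de := expR_lipschitz a'0 a0.
have e1 : expR a <= 1 by rewrite -[leRHS]expR0 ler_expR.
have step (t t' : R) : `|t'| <= 1 -> `|t' - t| <= `|b' - b| ->
    `|expR a' * t' - expR a * t| <= `|a' - a| + `|b' - b|.
  move=> t1 tt.
  have -> : expR a' * t' - expR a * t = (expR a' - expR a) * t' + expR a *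
    (t' - t) by ring.
  apply: (le_trans (ler_normD _ _)); rewrite !normrM lerD//.
    by rewrite (le_trans _ de)// ler_piMr.
  by rewrite (le_trans _ tt)// ler_piMl// ger0_norm ?expR_ge0.
have s1 := step (cos b) (cos b') (cos_max _) (cos_lipschitz _ _).
have s2 := step (sin b) (sin b') (sin_max _) (sin_lipschitz _ _).
have -> : 6 * (a ^+ 2 + b ^+ 2) / m = 2 * ((a ^+ 2 + b ^+ 2) / m) + 2 * (2 *
  (a ^+ 2 + b ^+ 2) / m).
  by field.
by lra.
Qed.

(** * The characteristic functions of the two laws *)

Lemma cos_transform_distribution (R : realType) d (T : measurableType d)
    (P : probability T R) (X : {RV P >-> R}) (z : R) :
  cos_transform (distribution P X) z = (\int[P]_w cos (z * X w))%R.
Proof.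
have mc : measurable_fun setT (fun u : R => cos (z * u)).
  by apply: measurable_comp (@measurable_cos R) _; exact: measurable_funM.
rewrite /cos_transform /Rintegral integral_distribution//.
  exact/measurable_EFinP.
apply: (@integrable_bounded _ _ _ P (fun w => cos (z * X w)) 1) => [|w];
  last exact: cos_max.
by apply: (measurable_comp mc).
Qed.

Lemma sin_transform_distribution (R : realType) d (T : measurableType d)
    (P : probability T R) (X : {RV P >-> R}) (z : R) :
  sin_transform (distribution P X) z = (\int[P]_w sin (z * X w))%R.
Proof.
have mc : measurable_fun setT (fun u : R => sin (z * u)).
  by apply: measurable_comp (@measurable_sin R) _; exact: measurable_funM.
rewrite /sin_transform /Rintegral integral_distribution//.
  exact/measurable_EFinP.
apply: (@integrable_bounded _ _ _ P (fun w => sin (z * X w)) 1) => [|w];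
  last exact: sin_max.
by apply: (measurable_comp mc).
Qed.

Lemma half_logN (R : realType) (y : R) : half_log (- y) = half_log y.
Proof. by rewrite /half_log sqrrN. Qed.

Lemma gamma_difference_transform (R : realType) (n : nat)
    (alpha p beta q w1 w2 : 'I_n -> R)
    (halpha : forall j, 0 < alpha j) (hbeta : forall j, 0 < beta j)
    (hw1 : forall j, 0 < w1 j) (hw2 : forall j, 0 < w2 j)
    d (Omega : measurableType d) (P : probability Omega R)
    (X Y : 'I_n -> {RV P >-> R})
    (hXY : mutually_independent
       (fun i : 'I_n + 'I_n => match i with inl j => X j | inr j => Y j end))
    (hX : forall j, is_gamma (distribution P (X j)) (alpha j) (p j))
    (hY : forall j, is_gamma (distribution P (Y j)) (beta j) (q j))
    (T : {RV P >-> R})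
    (hT : forall omega,
       T omega = \sum_(j < n) (w1 j * X j omega - w2 j * Y j omega)) (z : R) :
  let a := exponent_re alpha p beta q w1 w2 z in
  let b := exponent_im alpha p beta q w1 w2 z in
  cos_transform (distribution P T) z = expR a * cos b /\
  sin_transform (distribution P T) z = expR a * sin b.
Proof.
move=> a b.
pose V (i : 'I_n + 'I_n) : {RV P >-> R} := match i with inl j => X j | inr j => Y j end.
pose t (i : 'I_n + 'I_n) : R := match i with inl j => z * w1 j | inr j => -
  (z * w2 j) end.
pose A (i : 'I_n + 'I_n) : R := match i with
  | inl j => - (p j * half_log (z / (alpha j / w1 j)))
  | inr j => - (q j * half_log (z / (beta j / w2 j))) end.
pose B (i : 'I_n + 'I_n) : R := match i with
  | inl j => p j * atan (z / (alpha j / w1 j))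
  | inr j => - (q j * atan (z / (beta j / w2 j))) end.
have e1 j : z * w1 j / alpha j = z / (alpha j / w1 j).
  by field; rewrite !gt_eqF.
have e2 j : - (z * w2 j) / beta j = - (z / (beta j / w2 j)).
  by field; rewrite !gt_eqF.
have trV i : (\int[P]_w cos (t i * V i w))%R = expR (A i) * cos (B i) /\
             (\int[P]_w sin (t i * V i w))%R = expR (A i) * sin (B i).
  rewrite -cos_transform_distribution -sin_transform_distribution.
  case: i => j /=.
    by have := gamma_transform (z * w1 j) (hX j); rewrite e1.
  by have := gamma_transform (- (z * w2 j)) (hY j); rewrite e2 half_logN atanN mulrN.
have sumA : \sum_i A i = a.
  by rewrite big_sumType /= /a /exponent_re big_split/= opprD !sumrN.
have sumB : \sum_i B i = b.
  by rewrite big_sumType /= /b /exponent_im big_split/=.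
have sumT w : \sum_i t i * V i w = z * T w.
  rewrite hT big_sumType /= mulr_sumr -big_split/=; apply: eq_bigr => j _; ring.
have ind := independent_trig_sum hXY (fun i => (trV i).1) (fun i => (trV i).2)
  (r := index_enum _)
  (s := [::]) (E := fun=> setT).
have u : uniq (index_enum ('I_n + 'I_n)%type ++ [::]) by rewrite cats0 index_enum_uniq.
rewrite cos_transform_distribution sin_transform_distribution; split.
  have := ind 1 0 u (fun=> measurableT);
    rewrite big_nil sumA sumB mulr1 mul1r mul0r addr0 => <-.
  by apply: eq_Rintegral => w _; rewrite big_nil mulr1 mul1r mul0r addr0 sumT.
have := ind 0 1 u (fun=> measurableT);
  rewrite big_nil sumA sumB mulr1 mul1r mul0r add0r => <-.
by apply: eq_Rintegral => w _; rewrite big_nil mulr1 mul1r mul0r add0r sumT.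
Qed.

Lemma compound_poisson_transform (R : realType) (n : nat)
    (alpha p beta q w1 w2 : 'I_n -> R)
    (halpha : forall j, 0 < alpha j) (hbeta : forall j, 0 < beta j)
    (hw1 : forall j, 0 < w1 j) (hw2 : forall j, 0 < w2 j)
    (m : nat) (Q : probability R R) (z : R) :
  charfun Q z = cexp (m%:R * (phi_root alpha p beta q w1 w2 m z - 1)) ->
  let a := exponent_re alpha p beta q w1 w2 z in
  let b := exponent_im alpha p beta q w1 w2 z in
  let a' := m%:R * (expR (a / m%:R) * cos (b / m%:R) - 1) in
  let b' := m%:R * (expR (a / m%:R) * sin (b / m%:R)) in
  cos_transform Q z = expR a' * cos b' /\ sin_transform Q z = expR a' * sin b'.
Proof.
move=> + a b a' b'; rewrite charfunE /phi_root levy_integralE//.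
have mC : m%:R = (m%:R : R)%:C%C :> R[i] by rewrite rmorph_nat.
have mV : (m%:R : R[i])^-1 = ((m%:R : R)^-1)%:C%C by rewrite mC fmorphV.
have -> : (m%:R : R[i])^-1 * (a +i* b)%C = ((a / m%:R) +i* (b / m%:R))%C.
  by rewrite mV; apply/eqP; rewrite eq_complex /=; apply/andP; split; apply/eqP; ring.
rewrite cexpE mC.
set w := (X in cexp X).
have -> : w = (a' +i* b')%C.
  by rewrite /w; apply/eqP; rewrite eq_complex /=; apply/andP; split; apply/eqP;
    rewrite /a' /b'; ring.
by rewrite cexpE => -[-> ->].
Qed.

(** * Size of the characteristic exponent *)

Lemma half_log_ge0 (R : realType) (y : R) : 0 <= half_log y.
Proof. by rewrite /half_log divr_ge0// ln_ge0// lerDl sqr_ge0. Qed.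

Lemma half_log_le (R : realType) (y : R) : 0 <= y -> half_log y <= ln (1 + y).
Proof.
move=> y0; rewrite /half_log ler_pdivrMr// mulr_natr -lnXn; last lra.
by rewrite ler_ln ?posrE; [nra|nra|rewrite exprn_gt0//; lra].
Qed.

Lemma half_log_ge (R : realType) (y : R) : 0 < y -> ln y <= half_log y.
Proof.
move=> y0; rewrite /half_log ler_pdivlMr// mulr_natr -lnXn//.
by rewrite ler_ln ?posrE ?exprn_gt0//; [lra|rewrite ltr_pwDl// sqr_ge0].
Qed.

Lemma atan_norm_le (R : realType) (y : R) : `|atan y| <= `|y| /\ `|atan y| <= 2.
Proof.
split.
  have := @lipschitz_of_derive R atan (fun t => (1 + t ^+ 2)^-1) y 0.
  rewrite atan0 !subr0; apply=> t.
  have p0 : 0 < 1 + t ^+ 2 by rewrite ltr_pwDl// sqr_ge0.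
  by rewrite ger0_norm ?invr_ge0 ?(ltW p0)// invf_le1// lerDl sqr_ge0.
have := atan_gtNpi2 y; have := atan_ltpi2 y; have := @pihalf_lt2 R => h1 h2 h3.
by rewrite ler_norml; lra.
Qed.

(** Linear near the origin, logarithmic at infinity. *)
Lemma exponent_term_le (R : realType) (b z M : R) : 0 < b -> 1 <= M -> 0 < z <= M ->
  half_log (z / b) <= (b^-1 + 2) * (Num.min z 1 * (1 + ln M)) /\
  `|atan (z / b)| <= (b^-1 + 2) * (Num.min z 1 * (1 + ln M)).
Proof.
move=> b0 M1 /andP[z0 zM].
have bi : 0 < b^-1 by rewrite invr_gt0.
have bi' := ltW bi; have z0' := ltW z0.
have lM : 0 <= ln M by rewrite ln_ge0.
have y0 : 0 <= z / b by rewrite divr_ge0// ltW.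
have hl := half_log_le y0.
have [at1 at2] := atan_norm_le (z / b); rewrite (ger0_norm y0) in at1.
have y1 : ln (1 + z / b) <= z / b by rewrite le_ln1Dx//; lra.
have [z1|z1] := leP z 1.
  have zb : z / b <= (b^-1 + 2) * (z * (1 + ln M)).
    have : 0 <= b^-1 * (z * ln M) + 2 * (z * (1 + ln M)).
      by rewrite !(addr_ge0, mulr_ge0).
    by nra.
  by split; [exact: le_trans (le_trans hl y1) zb|exact: le_trans at1 zb].
rewrite mul1r.
have bl : 0 <= b^-1 * ln M by rewrite mulr_ge0// ltW.
split; last by nra.
apply: (le_trans hl).
apply: (@le_trans _ _ (ln ((1 + b^-1) * z))).
  by rewrite ler_ln ?posrE; [nra|nra|nra].
rewrite lnM ?posrE//; last by lra.
have h1 : ln (1 + b^-1) <= b^-1 by rewrite le_ln1Dx//; lra.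
have h2 : ln z <= ln M by rewrite ler_ln ?posrE//; lra.
by nra.
Qed.

Section ExponentBounds.
Context {R : realType} {n : nat}.
Variables alpha p beta q w1 w2 : 'I_n -> R.
Hypotheses (halpha : forall j, 0 < alpha j) (hbeta : forall j, 0 < beta j)
  (hp : forall j, 0 < p j) (hq : forall j, 0 < q j)
  (hw1 : forall j, 0 < w1 j) (hw2 : forall j, 0 < w2 j).
Local Notation a := (exponent_re alpha p beta q w1 w2).
Local Notation b := (exponent_im alpha p beta q w1 w2).

Definition exponent_const : R := \sum_(j < n)
  (p j * ((alpha j / w1 j)^-1 + 2) + q j * ((beta j / w2 j)^-1 + 2)).

Lemma exponent_const_ge0 : 0 <= exponent_const.
Proof.
apply: sumr_ge0 => j _.
by rewrite addr_ge0// mulr_ge0 ?addr_ge0 ?invr_ge0 ?divr_ge0 ?(ltW (halpha _), ltW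
  (hbeta _), ltW (hp _), ltW (hq _), ltW (hw1 _), ltW (hw2 _)).
Qed.

Lemma exponent_re_le0 z : a z <= 0.
Proof.
rewrite oppr_le0; apply: sumr_ge0 => j _.
by rewrite addr_ge0// mulr_ge0 ?half_log_ge0 ?(ltW (hp _), ltW (hq _)).
Qed.

Lemma exponent_le (z M : R) : 1 <= M -> 0 < z <= M ->
  `|a z| <= exponent_const * (Num.min z 1 * (1 + ln M)) /\
  `|b z| <= exponent_const * (Num.min z 1 * (1 + ln M)).
Proof.
move=> M1 zM.
have b1 j : 0 < alpha j / w1 j by rewrite divr_gt0.
have b2 j : 0 < beta j / w2 j by rewrite divr_gt0.
have p0 j := ltW (hp j); have q0 j := ltW (hq j).
rewrite /exponent_const mulr_suml; split.
  rewrite /exponent_re normrN (le_trans (ler_norm_sum _ _ _))//; apply: ler_sum => j _.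
  have [h1 _] := exponent_term_le (b1 j) M1 zM;
    have [h2 _] := exponent_term_le (b2 j) M1 zM.
  have s0 : 0 <= p j * half_log (z / (alpha j / w1 j)) + q j * half_log (z /
    (beta j / w2 j)).
    by apply: addr_ge0; apply: mulr_ge0 => //; exact: half_log_ge0.
  by rewrite (ger0_norm s0) mulrDl -!mulrA lerD// ler_wpM2l.
rewrite (le_trans (ler_norm_sum _ _ _))//; apply: ler_sum => j _.
have [_ h1] := exponent_term_le (b1 j) M1 zM;
  have [_ h2] := exponent_term_le (b2 j) M1 zM.
rewrite (le_trans (ler_normB _ _))// !normrM (ger0_norm (p0 j)) (ger0_norm (q0 j)).
by rewrite mulrDl -!mulrA lerD// ler_wpM2l.
Qed.

Lemma exponent_sqr_le (z M : R) : 1 <= M -> 0 < z <= M ->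
  a z ^+ 2 + b z ^+ 2 <=
    4 * (exponent_const * (1 + ln M)) ^+ 2 * (z ^+ 2 / (1 + z ^+ 2)).
Proof.
move=> M1 zM; have [ha hb] := exponent_le M1 zM.
have /andP[z0 _] := zM.
set L := exponent_const * (1 + ln M).
have L0 : 0 <= L by rewrite mulr_ge0 ?exponent_const_ge0// addr_ge0// ln_ge0.
have sq (x : R) : `|x| <= exponent_const * (Num.min z 1 * (1 + ln M)) ->
    x ^+ 2 <= L ^+ 2 * Num.min z 1 ^+ 2.
  rewrite mulrCA mulrC -/L => h; rewrite -exprMn -[leLHS]real_normK ?num_real//.
  by rewrite lerXn2r// nnegrE mulr_ge0// le_min (ltW z0) ler01.
have m2 : Num.min z 1 ^+ 2 <= 2 * (z ^+ 2 / (1 + z ^+ 2)).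
  have p0 : 0 < 1 + z ^+ 2 by rewrite ltr_pwDl// sqr_ge0.
  rewrite mulrA ler_pdivlMr//.
  case: (leP z 1) => z1; last by rewrite expr1n; nra.
  have : z ^+ 2 <= 1 by rewrite expr_le1// ltW.
  have := sqr_ge0 z; nra.
have := sq _ ha; have := sq _ hb; have := sqr_ge0 L => h1 h2 h3.
have : L ^+ 2 * Num.min z 1 ^+ 2 <= L ^+ 2 * (2 * (z ^+ 2 /
  (1 + z ^+ 2))) by rewrite ler_wpM2l.
by lra.
Qed.

(** A single gamma component already forces polynomial decay. *)
Lemma exponent_decay (j : 'I_n) (s z Zc : R) : 0 < s <= p j -> 0 < Zc <= z ->
  expR (a z) <= (Zc / (alpha j / w1 j)) `^ (- s).
Proof.
move=> /andP[s0 sp] /andP[Z0 Zz].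
have b1 : 0 < alpha j / w1 j by rewrite divr_gt0.
have y0 : 0 < Zc / (alpha j / w1 j) by rewrite divr_gt0.
have y1 : Zc / (alpha j / w1 j) <= z / (alpha j / w1 j) by rewrite ler_pM2r// invr_gt0.
have y2 := lt_le_trans y0 y1.
rewrite /powR gt_eqF// ler_expR.
have h1 := half_log_ge y2.
have h2 : ln (Zc / (alpha j / w1 j)) <= ln (z /
  (alpha j / w1 j)) by rewrite ler_ln ?posrE.
have h3 := half_log_ge0 (z / (alpha j / w1 j)).
have h4 : p j * half_log (z / (alpha j / w1 j)) <= - a z.
  rewrite /exponent_re opprK (bigD1 j)//= -addrA lerDl addr_ge0//.
    by rewrite mulr_ge0 ?half_log_ge0 ?(ltW (hq _)).
  apply: sumr_ge0 => i _.
  by rewrite addr_ge0// mulr_ge0 ?half_log_ge0 ?(ltW (hp _), ltW (hq _)).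
by nra.
Qed.

End ExponentBounds.

(** * Positivity of the second cumulant *)

(** Half of the exponent absorbs the factor [u]. *)
Lemma integral_mulX_expR_gt0 (R : realType) (b : R) : 0 < b ->
  mu.-integrable setT (EFin \o (fun u : R => \1_`]0, +oo[ u * (u * expR (-
    (b * u))))) /\
  0 < (\int[mu]_u (\1_`]0, +oo[ u * (u * expR (- (b * u)))))%R.
Proof.
move=> b0.
have b2 : 0 < b / 2 by rewrite divr_gt0.
have [ie _] := integral_expR_halfline b2.
have ie' := integrableZl measurableT (2 / b) ie.
have mf : measurable_fun setT (fun u : R => \1_`]0, +oo[ u * (u * expR (- (b * u)))).
  apply: measurable_funM; first exact: measurable_indic_itv.
  apply: measurable_funM => //; apply: measurable_comp (@measurable_expR R) _.
  by apply: measurable_funN; exact: measurable_funM.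
have fi : mu.-integrable setT (EFin \o (fun u : R => \1_`]0, +oo[ u * (u * expR (-
  (b * u))))).
  apply: (@integrable_of_le _ _ _ mu _ (fun u : R => 2 / b *
    (\1_`]0, +oo[ u * expR (- (b / 2 * u)))) mf _ ie') => u.
  rewrite !indic_itvE in_itv/= andbT.
  have [u0|u0] := boolP (0 < u); last by rewrite !mul0r mulr0 normr0.
  rewrite !mul1r ger0_norm ?mulr_ge0 ?expR_ge0 ?(ltW u0)//.
  have -> : - (b * u) = - (b / 2 * u) + - (b / 2 * u) by field.
  rewrite expRD mulrA ler_wpM2r ?expR_ge0// expRN ler_pdivrMr ?expR_gt0//.
  have h := expR_ge1Dx (b / 2 * u).
  by rewrite -ler_pdivrMl ?divr_gt0// invf_div; lra.
split=> //.
have l12 : 1 < 2 :> R by lra.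
have is_ := integrable_indic_segment l12.
have [_] := @integral_segment R (fun=> 1) (fun x => x) _ _ l12
    (fun x _ => isd_continuous (isd_cst 1 x)) (fun x _ => isd_id x).
have E1 (z : R) : \1_`[1, 2] z * 1 = \1_`[1, 2] z :> R by rewrite mulr1.
rewrite (eq_lebesgue E1) => es.
have j1 := integrableZl measurableT (expR (- (b * 2))) is_.
apply: (@lt_le_trans _ _ (\int[mu]_u (expR (- (b * 2)) * \1_`[1, 2] u))%R).
  by rewrite RintegralZl// es mulr_gt0 ?expR_gt0//; lra.
apply: le_Rintegral => // u _; rewrite !indic_itvE !in_itv/= andbT.
have [/andP[u1 u2]|_] := boolP (1 <= u <= 2); last first.
  rewrite mulr0; have [u0|u0] := boolP (0 < u); last by rewrite mul0r.
  by rewrite mul1r mulr_ge0 ?expR_ge0 ?(ltW u0).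
have u0 : 0 < u by lra.
rewrite u0 mulr1 mul1r.
have h1 : expR (- (b * 2)) <= expR (- (b * u)).
  by rewrite ler_expR lerN2 ler_pM2l.
have h2 := expR_ge0 (- (b * u)).
by nra.
Qed.

(** The factor [u^2] removes the singularity of the Levy density and makes both
    half-lines contribute with a positive sign. *)
Lemma cumulant2_gt0 (R : realType) (n : nat) (hn : (1 <= n)%N)
    (alpha p beta q w1 w2 : 'I_n -> R)
    (halpha : forall j, 0 < alpha j) (hp : forall j, 0 < p j)
    (hbeta : forall j, 0 < beta j) (hq : forall j, 0 < q j)
    (hw1 : forall j, 0 < w1 j) (hw2 : forall j, 0 < w2 j) :
  0 < cumulant alpha p beta q w1 w2 2.
Proof.
pose g (b u : R) : R := \1_`]0, +oo[ u * (u * expR (- (b * u))).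
pose f j (u : R) : R := p j * g (alpha j / w1 j) u + q j * g (beta j / w2 j) (-1 * u).
have b1 j : 0 < alpha j / w1 j by rewrite divr_gt0.
have b2 j : 0 < beta j / w2 j by rewrite divr_gt0.
have N1 : -1 != 0 :> R by rewrite oppr_eq0 oner_eq0.
have E (u : R) : u ^+ 2 * levy_density alpha p beta q w1 w2 u = \sum_(j < n) f j u.
  rewrite /levy_density mulrA mulr_sumr; apply: eq_bigr => j _.
  rewrite /f /g !indic_itvE !in_itv/= !andbT mulN1r oppr_gt0 !mulrN.
  have -> : alpha j / w1 j * u = alpha j * u / w1 j by ring.
  have [u0|u0|->] := ltgtP u 0.
  - rewrite ltr0_norm//.
    have -> : - (beta j / w2 j * u) = beta j * - u / w2 j by ring.
    have u1 : u != 0 by rewrite lt_eqF.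
    rewrite !mulr0 mul0r add0r; by field.
  - have u1 : u != 0 by rewrite gt_eqF.
    by rewrite /=; field.
  - by rewrite /= !(mulr0, mul0r, invr0, subr0, addr0, expr0n).
have fi j : mu.-integrable setT (EFin \o f j) /\ 0 < (\int[mu]_u f j u)%R.
  have [i1 e1] := integral_mulX_expR_gt0 (b1 j).
  have [i2 e2] := integral_mulX_expR_gt0 (b2 j).
  have := Rintegral_scale N1 i2; rewrite normrN normr1 mul1r => e3.
  have i2' := integrable_scale N1 i2.
  have i3 := integrableZl measurableT (p j) i1.
  have i4 := integrableZl measurableT (q j) i2'.
  split; first exact: (integrableD measurableT i3 i4).
  rewrite RintegralD// !RintegralZl// -e3.
  exact: addr_gt0 (mulr_gt0 (hp j) e1) (mulr_gt0 (hq j) e2).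
rewrite /cumulant (eq_lebesgue E).
have [_ ->] := Rintegral_sum (index_enum 'I_n) (fun j => (fi j).1).
rewrite (bigD1 (Ordinal hn))//= ltr_pwDl//; first exact: (fi _).2.
by apply: sumr_ge0 => j _; exact: ltW (fi j).2.
Qed.

(** * The rate of convergence *)

Lemma normr_expR_cos_le (R : realType) (a b : R) : `|expR a * cos b| <= expR a.
Proof. by rewrite normrM ger0_norm ?expR_ge0// ler_piMr ?expR_ge0// cos_max. Qed.

Lemma normr_expR_sin_le (R : realType) (a b : R) : `|expR a * sin b| <= expR a.
Proof. by rewrite normrM ger0_norm ?expR_ge0// ler_piMr ?expR_ge0// sin_max. Qed.

Lemma ln_onem_sqr_le (R : realType) (M : R) : 1 <= M -> ln (1 + M ^+ 2) <= 2 *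
  (1 + ln M).
Proof.
move=> M1; have M0 : 0 < M by lra.
apply: (@le_trans _ _ (ln (2 * M ^+ 2))).
  rewrite ler_ln ?posrE; first by nra.
    by rewrite ltr_pwDl// sqr_ge0.
  by rewrite mulr_gt0// exprn_gt0.
have h : ln 2 <= 1 :> R by apply: (@le_ln1Dx R 1); lra.
by rewrite lnM ?posrE ?exprn_gt0// lnXn// mulr2n; lra.
Qed.

(** [ln mu = (15/4) ln (mu ^ (4/15))], and three such factors cost
    [mu ^ (4/5)]. *)
Lemma log_cube_le (R : realType) (a mu : R) : 0 <= a -> 1 <= mu ->
  (1 + ln (mu `^ a)) ^+ 3 / mu <= (1 + a * (15 / 4)) ^+ 3 * mu `^ (- (1 / 5)).
Proof.
move=> a0 m1; have m0 : 0 < mu by lra.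
set t := mu `^ (4 / 15).
have t1 : 1 <= t by rewrite -(powRr0 mu) ler_powR//; lra.
have lnt : ln mu = 15 / 4 * ln t by rewrite /t ln_powR; field.
have lnt' : ln t <= t by have := @le_ln1Dx R (t - 1); rewrite (_ : 1 + (t - 1) = t);
  [lra|ring].
have l0 : 0 <= ln mu by rewrite ln_ge0.
have h : 1 + ln (mu `^ a) <= (1 + a * (15 / 4)) * t.
  have h1 : a * ln t <= a * t by rewrite ler_wpM2l.
  by rewrite ln_powR lnt; lra.
have -> : mu `^ (- (1 / 5)) = t ^+ 3 / mu.
  transitivity (mu `^ (4 / 15 * 3) / mu `^ 1).
    by rewrite -powRB ?(gt_eqF m0) ?implybT//; congr (_ `^ _); field.
  by rewrite powRr1 ?(ltW m0)// powRrM powR_mulrn ?powR_ge0.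
rewrite mulrA ler_wpM2r ?invr_ge0 ?(ltW m0)// -exprMn lerXn2r// nnegrE.
  by rewrite addr_ge0// ln_powR mulr_ge0.
by rewrite mulr_ge0 ?(le_trans ler01 t1)//; nra.
Qed.

Lemma kolmogorov_dist_le (R : realType) d (T : measurableType d) (P : probability T R)
    d' (T' : measurableType d') (P' : probability T' R)
    (Y : {RV P >-> R}) (Z : {RV P' >-> R}) (B : R) :
  (forall x, `|fine (cdf Y x) - fine (cdf Z x)| <= B) -> kolmogorov_dist Y Z <= B.
Proof.
move=> H; apply: ge_sup; first by exists `|fine (cdf Y 0) - fine (cdf Z 0)|; exists 0.
by move=> _ [x _ <-]; exact: H.
Qed.

Theorem lemma4p4 (R : realType) (n : nat) (hn : (1 <= n)%N)
    (alpha p beta q w1 w2 : 'I_n -> R)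
    (halpha : forall j, 0 < alpha j) (hp : forall j, 0 < p j)
    (hbeta : forall j, 0 < beta j) (hq : forall j, 0 < q j)
    (hw1 : forall j, 0 < w1 j) (hw2 : forall j, 0 < w2 j)
    (d : measure_display) (Omega : measurableType d) (P : probability Omega R)
    (X Y : 'I_n -> {RV P >-> R})
    (hXY : mutually_independent
       (fun i : 'I_n + 'I_n => match i with inl j => X j | inr j => Y j end))
    (hX : forall j, is_gamma (distribution P (X j)) (alpha j) (p j))
    (hY : forall j, is_gamma (distribution P (Y j)) (beta j) (q j))
    (T : {RV P >-> R})
    (hT : forall omega,
       T omega = \sum_(j < n) (w1 j * X j omega - w2 j * Y j omega))
    (d' : nat -> measure_display) (Omega' : forall m, measurableType (d' m))
    (P' : forall m, probability (Omega' m) R)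
    (Z : forall m, {RV (P' m) >-> R})
    (hZ : forall m, (1 <= m)%N -> is_compound_poisson (distribution (P' m) (Z m)))
    (hphi : forall m, (1 <= m)%N -> forall z : R,
       charfun (distribution (P' m) (Z m)) z =
       cexp (m%:R * (phi_root alpha p beta q w1 w2 m z - 1))) :
  exists c : R, 0 < c /\
    forall m, (1 <= m)%N ->
      kolmogorov_dist (Z m) T <=
        c * (\sum_(1 <= j < 3) `|cumulant alpha p beta q w1 w2 j|) `^ (2 / 5)
          * (1 / m%:R) `^ (1 / 5).
Proof.
pose j0 := Ordinal hn.
pose b0 := alpha j0 / w1 j0.
have b0_gt0 : 0 < b0 by rewrite divr_gt0.
pose s := Num.min (p j0) 1.
have s0 : 0 < s by rewrite lt_min hp ltr01.
have s1 : s <= 1 by rewrite ge_min lexx orbT.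
have sp : s <= p j0 by rewrite ge_min lexx.
pose K := exponent_const alpha p beta q w1 w2.
have K0 : 0 <= K by exact: exponent_const_ge0.
(* With smoothing scale [e = m^-r] and decay [z^-s] from [Zc = e^(-1/2)] on, the
   concentration terms are [e^(1/2)] and [e^(s/2)]; this [r] makes the second
   one [m^(-1/5)], and [s <= 1] makes the first one no larger. *)
pose r : R := 2 / (5 * s).
have r0 : 0 < r by rewrite divr_gt0// mulr_gt0.
pose L : R := (1 + (1 + r) * (15 / 4)) ^+ 3.
have L0 : 0 <= L by rewrite exprn_ge0//; nra.
pose C0 := (tent_const R)^-1 * (24 * K ^+ 2 * L + 8) + (4 + 4 * b0 `^ s).
have tc := tent_const_gt0 R.
have C00 : 0 < C0.
  rewrite /C0 ltr_wpDl//; last by rewrite ltr_pwDl// mulr_ge0// powR_ge0.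
  apply: mulr_ge0; first by rewrite invr_ge0 ltW.
  have h : 0 <= K ^+ 2 * L by rewrite mulr_ge0// sqr_ge0.
  by nra.
pose V := \sum_(1 <= j < 3) `|cumulant alpha p beta q w1 w2 j|.
have V0 : 0 < V.
  rewrite /V big_nat_recr//= ltr_wpDl ?sumr_ge0//.
  by rewrite normr_gt0 gt_eqF// cumulant2_gt0.
exists (C0 / V `^ (2 / 5)); split; first by rewrite divr_gt0// powR_gt0.
move=> m m1; rewrite -/V divfK ?gt_eqF ?powR_gt0//.
pose x := (m%:R : R).
have x1 : 1 <= x by rewrite ler1n.
have x0 : 0 < x by lra.
have -> : (1 / m%:R : R) `^ (1 / 5) = x `^ (- (1 / 5)).
  by rewrite div1r -/x powRN -powR_inv1 ?(ltW x0)// powRAC powR_inv1// powR_ge0.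
set rate := x `^ (- (1 / 5)).
(* [M] is such that [e * M = m]. *)
pose e := x `^ (- r); pose M := x `^ (1 + r); pose Zc := x `^ (r / 2).
have e0 : 0 < e by rewrite powR_gt0.
have M0 : 0 < M by rewrite powR_gt0.
have Z0 : 0 < Zc by rewrite powR_gt0.
have M1 : 1 <= M by rewrite -(powRr0 x) ler_powR//; lra.
pose ell := 1 + ln M.
have ell0 : 0 <= ell by rewrite addr_ge0// ln_ge0.
pose eta := 24 * (K * ell) ^+ 2 / x.
pose theta := (Zc / b0) `^ (- s).
pose a z := exponent_re alpha p beta q w1 w2 z.
pose b z := exponent_im alpha p beta q w1 w2 z.
have trT z : cos_transform (distribution P T) z = expR (a z) * cos (b z) /\
    sin_transform (distribution P T) z = expR (a z) * sin (b z).
  exact: (gamma_difference_transform halpha hbeta hw1 hw2 hXY hX hY hT).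
have QP z : 0 < z <= M ->
   `|cos_transform (distribution (P' m) (Z m)) z - cos_transform (distribution P T) z| +
   `|sin_transform (distribution (P' m) (Z m)) z - sin_transform (distribution P T) z|
     <= eta * (z ^+ 2 / (1 + z ^+ 2)).
  move=> zM.
  have [-> ->] := compound_poisson_transform halpha hbeta hw1 hw2 (hphi m m1 z).
  have [-> ->] := trT z.
  rewrite -/(a z) -/(b z).
  have az : a z <= 0 by exact: exponent_re_le0.
  apply: le_trans (compound_poisson_approx x0 az erefl erefl) _.
  have h := exponent_sqr_le halpha hbeta hp hq hw1 hw2 M1 zM.
  have -> : eta * (z ^+ 2 / (1 + z ^+ 2)) =
      6 * (4 * (K * ell) ^+ 2 * (z ^+ 2 / (1 + z ^+ 2))) / x by rewrite /eta; ring.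
  by rewrite ler_pM2r ?invr_gt0// ler_pM2l.
have decay z : Zc <= z -> `|cos_transform (distribution P T) z| <= theta /\
     `|sin_transform (distribution P T) z| <= theta.
  move=> Zz; have [-> ->] := trT z.
  have h : expR (a z) <= theta.
    by apply: exponent_decay; rewrite ?s0 ?Z0.
  by split; apply: le_trans h; [exact: normr_expR_cos_le|exact: normr_expR_sin_le].
have eta0 : 0 <= eta by rewrite divr_ge0 ?(ltW x0)// mulr_ge0 ?sqr_ge0.
have D := cdf_dist_le e0 M0 eta0 Z0 (powR_ge0 _ _) QP decay.
apply: kolmogorov_dist_le => y; apply: (le_trans (D y)).
have rate0 : 0 < rate by rewrite powR_gt0.
have eM : (e * M)^-1 <= rate.
  have -> : e * M = x `^ 1.
    by rewrite /e /M -powRD ?(gt_eqF x0) ?implybT//; congr (_ `^ _); ring.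
  by rewrite -powRN ler_powR//; lra.
have etaL : eta / 2 * ln (1 + M ^+ 2) <= 24 * K ^+ 2 * L * rate.
  have h1 := ln_onem_sqr_le M1; have h2 := @log_cube_le R (1 + r) x _ x1.
  have h3 : ell ^+ 3 / x <= L * rate by apply: h2; lra.
  apply: (@le_trans _ _ (eta / 2 * (2 * ell))).
    by rewrite ler_wpM2l// divr_ge0.
  have -> : eta / 2 * (2 * ell) = 24 * K ^+ 2 * (ell ^+ 3 / x) by rewrite /eta;
    field; rewrite gt_eqF.
  by rewrite -[leRHS]mulrA ler_wpM2l// mulr_ge0 ?sqr_ge0.
have eZ : e * Zc <= rate.
  rewrite /e /Zc -powRD ?(gt_eqF x0) ?implybT// ler_powR//.
  have : 1 / 5 <= r / 2 by rewrite /r invfM mulrA ler_pdivlMr// mulrAC ler_pdivlMr//;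
    lra.
  by lra.
have thE : theta = b0 `^ s * rate.
  rewrite /theta powRM ?invr_ge0 ?(ltW Z0) ?(ltW b0_gt0)// mulrC; congr (_ * _).
    by rewrite -powR_inv1 ?(ltW b0_gt0)// -powRrM mulN1r opprK.
  by rewrite /rate /Zc -powRrM; congr (_ `^ _); rewrite /r; field; rewrite gt_eqF.
have -> : C0 * rate = (tent_const R)^-1 * ((24 * K ^+ 2 * L + 8) * rate) +
    (4 * rate + 4 * theta) by rewrite thE /C0; ring.
apply: lerD; last by rewrite lerD2r ler_wpM2l.
apply: ler_wpM2l; first by rewrite invr_ge0 ltW.
by rewrite [leRHS]mulrDl; apply: lerD => //; exact: ler_wpM2l.
Qed.
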